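(* Let $\bm{A}\in\mathbb{R}^{d\times n}$, $\bm{y}\in\mathbb{R}^{d}$, $\bm{L}\in\mathbb{R}^{m\times n}$, $\bm{B}\in\mathbb{R}^{q\times m}$, $\bm{M}\in\mathbb{R}^{p\times l}$, $\lambda>0$, let $\mathcal{C}\subset\mathbb{R}^{n}$ be nonempty closed convex, and let $\varphi\in\Gamma_0(\mathbb{R}^{m}\times\mathbb{R}^{l})$, $f\in\Gamma_0(\mathbb{R}^{m}\times\mathbb{R}^{l})$, $g\in\Gamma_0(\mathbb{R}^{p})$ satisfy Assumptions (A1), (A2), (A3) of the context. Assume also $$\bm{Q}:=\bm{A}^{\top}\bm{A}-\lambda\bm{L}^{\top}\bm{B}^{\top}\bm{B}\bm{L}\succeq\bm{O}.$$ Let $\kappa>1$ and $\gamma_1,\gamma_2,\gamma_3,\gamma_4>0$ satisfy $$\frac{1}{\gamma_1}\bm{I}-\frac{\kappa}{2}\bm{A}^{\top}\bm{A}-\lambda\bm{L}^{\top}\bm{L}\succ\bm{O},\quad \frac{1}{\gamma_2}\bm{I}-\bm{I}-\bm{M}^{\top}\bm{M}\succ\bm{O},\quad \frac{1}{\gamma_3}\ge\left(\frac{\kappa}{2}+\frac{2}{\kappa}\right)\|\bm{B}\|_{\mathrm{op}}^2,\quad \frac{1}{\gamma_4}\bm{I}-\gamma_3\bm{M}\bm{M}^{\top}\succ\bm{O}.$$ Let $\mathcal{H}:=\mathbb{R}^{n}\times\mathbb{R}^{l}\times\mathbb{R}^{m}\times\mathbb{R}^{l}\times\mathbb{R}^{m}\times\mathbb{R}^{l}\times\mathbb{R}^{p}\times\mathbb{R}^{p}$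 and define $T:\mathcal{H}\to\mathcal{H}$, $(\bm{x},\bm{\sigma},\bm{v},\bm{\tau},\bm{r},\bm{\eta},\bm{\xi},\bm{\zeta})\mapsto(\hat{\bm{x}},\hat{\bm{\sigma}},\hat{\bm{v}},\hat{\bm{\tau}},\hat{\bm{r}},\hat{\bm{\eta}},\hat{\bm{\xi}},\hat{\bm{\zeta}})$ by $$\begin{aligned} \hat{\bm{x}}&:=P_{\mathcal{C}}[\bm{x}-\gamma_1(\bm{Q}\bm{x}-\bm{A}^{\top}\bm{y}+\lambda\bm{L}^{\top}\bm{B}^{\top}\bm{B}\bm{v}+\lambda\bm{L}^{\top}\bm{r})],\\ \hat{\bm{\sigma}}&:=\bm{\sigma}-\gamma_2(\bm{\eta}+\bm{M}^{\top}\bm{\xi}),\\ (\hat{\bm{v}},\hat{\bm{\tau}})&:=\mathrm{prox}_{\gamma_3 f}(\bm{v}+\gamma_3\bm{B}^{\top}\bm{B}(\bm{L}(2\hat{\bm{x}}-\bm{x})-\bm{v}),\ \bm{\tau}-\gamma_3\bm{M}^{\top}\bm{\zeta}),\\ (\hat{\bm{r}},\hat{\bm{\eta}})&:=\mathrm{prox}_{f^{*}}(\bm{r}+\bm{L}(2\hat{\bm{x}}-\bm{x}),\ \bm{\eta}+2\hat{\bm{\sigma}}-\bm{\sigma}),\\ \hat{\bm{\xi}}&:=\mathrm{prox}_{g^{*}}(\bm{\xi}+\bm{M}(2\hat{\bm{\sigma}}-\bm{\sigma})),\\ \hat{\bm{\zeta}}&:=\mathrm{prox}_{\gamma_4 g^{*}}(\bm{\zeta}+\gamma_4\bm{M}(2\hat{\bm{\tau}}-\bm{\tau})).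 \end{aligned}$$ Let $\bm{P}$ be the linear operator on $\mathcal{H}$ given by $$\bm{P}(\bm{x},\bm{\sigma},\bm{v},\bm{\tau},\bm{r},\bm{\eta},\bm{\xi},\bm{\zeta}):=\begin{bmatrix} (1/\gamma_1)\bm{x}-\lambda\bm{L}^{\top}\bm{B}^{\top}\bm{B}\bm{v}-\lambda\bm{L}^{\top}\bm{r}\\ (\lambda/\gamma_2)\bm{\sigma}-\lambda\bm{\eta}-\lambda\bm{M}^{\top}\bm{\xi}\\ (\lambda/\gamma_3)\bm{v}-\lambda\bm{B}^{\top}\bm{B}\bm{L}\bm{x}\\ (\lambda/\gamma_3)\bm{\tau}-\lambda\bm{M}^{\top}\bm{\zeta}\\ \lambda\bm{r}-\lambda\bm{L}\bm{x}\\ \lambda\bm{\eta}-\lambda\bm{\sigma}\\ \lambda\bm{\xi}-\lambda\bm{M}\bm{\sigma}\\ (\lambda/\gamma_4)\bm{\zeta}-\lambda\bm{M}\bm{\tau} \end{bmatrix}.$$ Then, with $\mathcal{S}:=\mathrm{argmin}_{\bm{x}\in\mathcal{C}}J(\bm{x})$: (1) $\bm{x}^{\star}\in\mathcal{S}$ if and only if there exist $\bm{\sigma}^{\star},\bm{v}^{\star},\bm{\tau}^{\star},\bm{r}^{\star},\bm{\eta}^{\star},\bm{\xi}^{\star},\bm{\zeta}^{\star}$ such that $(\bm{x}^{\star},\bm{\sigma}^{\star},\bm{v}^{\star},\bm{\tau}^{\star},\bm{r}^{\star},\bm{\eta}^{\star},\bm{\xi}^{\star},\bm{\zeta}^{\star})\in\mathrm{Fix}(T)$.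 (2) $\bm{P}$ is positive definite, and $T$ is $\kappa/(2\kappa-1)$-averaged nonexpansive in $\mathcal{H}$ equipped with the inner product $\langle\cdot,\cdot\rangle_{\bm{P}}$ and norm $\|\cdot\|_{\bm{P}}$. (3) If $\mathcal{S}\neq\varnothing$, then for every initial point $\bm{z}_0=(\bm{x}_0,\bm{\sigma}_0,\bm{v}_0,\bm{\tau}_0,\bm{r}_0,\bm{\eta}_0,\bm{\xi}_0,\bm{\zeta}_0)\in\mathcal{H}$, the sequence $\bm{z}_{k+1}=T(\bm{z}_k)$, $\bm{z}_k=(\bm{x}_k,\bm{\sigma}_k,\bm{v}_k,\bm{\tau}_k,\bm{r}_k,\bm{\eta}_k,\bm{\xi}_k,\bm{\zeta}_k)$, is such that $(\bm{x}_k)_{k\in\mathbb{N}}$ converges to a point of $\mathcal{S}$.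
   Context: Euclidean spaces (and their products) carry the standard inner product and norm. $\Gamma_0(\mathbb{R}^{N})$ is the set of proper lower semicontinuous convex functions $\mathbb{R}^{N}\to\mathbb{R}\cup\{\infty\}$; $\mathrm{dom}(f)=\{\bm{x}\mid f(\bm{x})<\infty\}$; coercive means $f(\bm{x})\to\infty$ as $\|\bm{x}\|\to\infty$; $f^{*}(\bm{w})=\sup_{\bm{x}}[\langle\bm{x},\bm{w}\rangle-f(\bm{x})]$; $\mathrm{prox}_f(\bm{x})=\mathrm{argmin}_{\bm{y}}[f(\bm{y})+\frac12\|\bm{x}-\bm{y}\|^2]$; $P_{\mathcal{C}}$ is the metric projection onto $\mathcal{C}$; $\iota_{\mathcal{C}}$ is the indicator function ($0$ on $\mathcal{C}$, $\infty$ elsewhere). $\|\cdot\|_{\mathrm{op}}$ is the operator norm; $\succ\bm{O}$, $\succeq\bm{O}$ mean positive definite, positive semidefinite; $\mathrm{ri}$ is the relative interior; $\mathrm{ran}$ is the range. For positive definite $\bm{P}$, $\langle\bm{z},\bm{w}\rangle_{\bm{P}}=\langle\bm{z},\bm{P}\bm{w}\rangle$ and $\|\cdot\|_{\bm{P}}$ is the associated norm. $\mathrm{Fix}(T)=\{\bm{z}\mid T(\bm{z})=\bm{z}\}$. An operator is nonexpansive if it is 1-Lipschitz; $T$ is $\alpha$-averaged nonexpansive, $\alpha\in(0,1)$, if $T=(1-\alpha)\mathrm{Id}+\alpha R$ for some nonexpansive $R$. Definitions: $\psi(\bm{u})=\min_{\bm{\sigma}\in\mathbb{R}^{l}}\varphi(\bm{u},\bm{\sigma})$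 for $\bm{u}\in\mathbb{R}^{m}$ (attained under (A1)); $\Psi_{\bm{B}}(\bm{u})=\psi(\bm{u})-\inf_{\bm{v}\in\mathbb{R}^{m}}[\psi(\bm{v})+\frac12\|\bm{B}(\bm{u}-\bm{v})\|^2]$; $J(\bm{x})=\frac12\|\bm{y}-\bm{A}\bm{x}\|^2+\lambda\Psi_{\bm{B}}(\bm{L}\bm{x})$. Assumptions. (A1) $\varphi$ is bounded below, and $\varphi(\bm{u},\cdot)$ is proper and coercive for every $\bm{u}\in\mathbb{R}^{m}$. (A2) $\varphi(\bm{u},\bm{\sigma})=f(\bm{u},\bm{\sigma})+g(\bm{M}\bm{\sigma})$, where $f$, $g$ and $\iota_{\mathcal{C}}$ are prox-friendly. (Prox-friendly means that $\mathrm{prox}_{\gamma f}$ is available as a computational tool for any $\gamma>0$; this concerns implementability only and imposes no mathematical restriction.) (A3) With $\bar{\bm{L}}:=\begin{bmatrix}\bm{L}&\bm{O}\\\bm{O}&\bm{I}\end{bmatrix}\in\mathbb{R}^{(m+l)\times(n+l)}$ and $\bar{\bm{M}}:=\begin{bmatrix}\bm{O}&\bm{M}\end{bmatrix}\in\mathbb{R}^{p\times(m+l)}$: (i) either $\varphi(-\bm{u},\bm{\sigma})=\varphi(\bm{u},\bm{\sigma})$ for all $(\bm{u},\bm{\sigma})$, or $\varphi(-\bm{u},\bm{\sigma})=\varphi(\bm{u},-\bm{\sigma})$ for all $(\bm{u},\bm{\sigma})$; (ii) $\bm{0}\in\mathrm{ri}[\mathrm{dom}(\varphi)-\mathrm{ran}(\bar{\bm{L}})]$;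 (iii) $\bm{0}\in\mathrm{ri}[\mathrm{dom}(g)-\bar{\bm{M}}(\mathrm{dom}(f))]$. *)

(* Defs.v *)
(* MathComp-Analysis, over an arbitrary R : realType. *)
From HB Require Import structures.
From mathcomp Require Import all_boot all_order all_algebra.
From mathcomp Require Import all_classical all_reals all_analysis.

Set Implicit Arguments.
Unset Strict Implicit.
Unset Printing Implicit Defensive.

Import Order.TTheory GRing.Theory Num.Theory.
Import numFieldNormedType.Exports.

Local Open Scope classical_set_scope.
Local Open Scope ring_scope.

(* R^N is 'cV[R]_N, and R^m x R^l is 'cV[R]_(m + l) with the pair (u, s) written
   col_mx u s.  The norm `|_| that the library puts on 'cV[R]_N is the max norm,
   so the Euclidean one is defined here; the topologies coincide. *)

Definition dot (R : realType) N (u v : 'cV[R]_N) : R := (u^T *m v) 0 0.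

Definition enorm (R : realType) N (u : 'cV[R]_N) : R := Num.sqrt (dot u u).

Definition opnorm (R : realType) q m (B : 'M[R]_(q, m)) : R :=
  sup [set enorm (B *m u) | u in [set u : 'cV[R]_m | enorm u <= 1]].

Definition psdmx (R : realType) N (S : 'M[R]_N) : Prop :=
  S^T = S /\ forall u : 'cV[R]_N, 0 <= dot u (S *m u).

Definition posdefmx (R : realType) N (S : 'M[R]_N) : Prop :=
  S^T = S /\ forall u : 'cV[R]_N, u != 0 -> 0 < dot u (S *m u).

Definition affine_hull (R : realType) N (S : set 'cV[R]_N) : set 'cV[R]_N :=
  [set x | exists k (a : 'I_k -> R) (s : 'I_k -> 'cV[R]_N),
     [/\ forall i, S (s i), \sum_i a i = 1 & x = \sum_i a i *: s i]].

Definition ri (R : realType) N (S : set 'cV[R]_N) : set 'cV[R]_N :=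
  [set x | S x /\ \forall z \near x, affine_hull S z -> S z].

Definition set_sub (R : realType) N (S S' : set 'cV[R]_N) : set 'cV[R]_N :=
  [set a - b | a in S & b in S'].

Definition argmin (R : realType) (V : Type) (S : set V) (F : V -> \bar R)
    : set V :=
  [set x | S x /\ forall z, S z -> (F x <= F z)%E].

Definition dom (R : realType) (V : Type) (f : V -> \bar R) : set V :=
  [set x | (f x < +oo)%E].

Definition proper_efun (R : realType) (V : Type) (f : V -> \bar R) : Prop :=
  (forall x, f x != -oo%E) /\ dom f !=set0.

Definition econvex (R : realType) (V : lmodType R) (f : V -> \bar R) : Prop :=
  forall (x z : V) (t : R), 0 < t < 1 ->
    (f (t *: x + (1 - t) *: z)%R <= t%:E * f x + (1 - t)%R%:E * f z)%E.

Definition Gamma0 (R : realType) N (f : 'cV[R]_N -> \bar R) : Prop :=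
  [/\ proper_efun f, lower_semicontinuous f & econvex f].

Definition coercive (R : realType) N (f : 'cV[R]_N -> \bar R) : Prop :=
  forall a : R, exists r : R, forall x, r < enorm x -> (a%:E < f x)%E.

Definition conjugate (R : realType) N (f : 'cV[R]_N -> \bar R)
    (w : 'cV[R]_N) : \bar R :=
  ereal_sup (range (fun x => (dot x w)%:E - f x)%E).

(* prox and proj pick a point of the argmin, and are 0 if it is empty.  The
   argmin is a singleton for f in Gamma0, resp. for S nonempty closed convex. *)
Definition prox (R : realType) N (f : 'cV[R]_N -> \bar R)
    (x : 'cV[R]_N) : 'cV[R]_N :=
  xget 0 (argmin setT (fun z => f z + (2^-1 * enorm (x - z) ^+ 2)%R%:E)%E).

Definition proj (R : realType) N (S : set 'cV[R]_N) (x : 'cV[R]_N)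
    : 'cV[R]_N :=
  xget 0 (argmin S (fun z => (enorm (x - z))%:E)).

Definition escale (R : realType) (V : Type) (c : R) (f : V -> \bar R)
    : V -> \bar R :=
  fun x => (c%:E * f x)%E.

(* The infimum over s is a minimum under assumption_A1. *)
Definition psi (R : realType) m l (phi : 'cV[R]_(m + l) -> \bar R)
    (u : 'cV[R]_m) : \bar R :=
  ereal_inf (range (fun s : 'cV[R]_l => phi (col_mx u s))).

Definition Psi (R : realType) m l q (phi : 'cV[R]_(m + l) -> \bar R)
    (B : 'M[R]_(q, m)) (u : 'cV[R]_m) : \bar R :=
  (psi phi u - ereal_inf (range (fun v : 'cV[R]_m =>
     psi phi v + (2^-1 * enorm (B *m (u - v)) ^+ 2)%R%:E)))%E.

Definition J (R : realType) d n m l q (A : 'M[R]_(d, n)) (y : 'cV[R]_d)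
    (L : 'M[R]_(m, n)) (B : 'M[R]_(q, m)) (lam : R)
    (phi : 'cV[R]_(m + l) -> \bar R) (x : 'cV[R]_n) : \bar R :=
  ((2^-1 * enorm (y - A *m x) ^+ 2)%R%:E + lam%:E * Psi phi B (L *m x)%R)%E.

Definition assumption_A1 (R : realType) m l
    (phi : 'cV[R]_(m + l) -> \bar R) : Prop :=
  (exists c : R, forall w, (c%:E <= phi w)%E) /\
  forall u : 'cV[R]_m, proper_efun (fun s : 'cV[R]_l => phi (col_mx u s)) /\
                       coercive (fun s : 'cV[R]_l => phi (col_mx u s)).

(* Prox-friendliness of f, g and the indicator of the constraint set is an
   implementability requirement with no mathematical content. *)
Definition assumption_A2 (R : realType) m l p
    (phi f : 'cV[R]_(m + l) -> \bar R) (g : 'cV[R]_p -> \bar R)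
    (M : 'M[R]_(p, l)) : Prop :=
  forall (u : 'cV[R]_m) (s : 'cV[R]_l),
    phi (col_mx u s) = (f (col_mx u s) + g (M *m s)%R)%E.

Definition Lbar (R : realType) m n l (L : 'M[R]_(m, n))
    : 'M[R]_(m + l, n + l) :=
  block_mx L 0 0 1%:M.

Definition Mbar (R : realType) m l p (M : 'M[R]_(p, l))
    : 'M[R]_(p, m + l) :=
  row_mx 0 M.

Definition assumption_A3 (R : realType) n m l p
    (phi f : 'cV[R]_(m + l) -> \bar R) (g : 'cV[R]_p -> \bar R)
    (L : 'M[R]_(m, n)) (M : 'M[R]_(p, l)) : Prop :=
  [/\ (forall (u : 'cV[R]_m) (s : 'cV[R]_l),
         phi (col_mx (- u) s) = phi (col_mx u s)) \/
      (forall (u : 'cV[R]_m) (s : 'cV[R]_l),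
         phi (col_mx (- u) s) = phi (col_mx u (- s))),
      ri (set_sub (dom phi) (range (fun w => Lbar l L *m w))) 0 &
      ri (set_sub (dom g) ((fun w => Mbar m M *m w) @` dom f)) 0].

Definition Qmx (R : realType) d n m q (A : 'M[R]_(d, n)) (L : 'M[R]_(m, n))
    (B : 'M[R]_(q, m)) (lam : R) : 'M[R]_n :=
  A^T *m A - lam *: (L^T *m B^T *m B *m L).

Notation Hspace R n m l p :=
  ('cV[R]_n * 'cV[R]_l * 'cV[R]_m * 'cV[R]_l * 'cV[R]_m * 'cV[R]_l *
   'cV[R]_p * 'cV[R]_p)%type.

Definition xpart (R : realType) n m l p (z : Hspace R n m l p) : 'cV[R]_n :=
  let: (x, _, _, _, _, _, _, _) := z in x.

Definition dotH (R : realType) n m l p (z w : Hspace R n m l p) : R :=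
  let: (x, s, v, t, r, eta, xi, zeta) := z in
  let: (x', s', v', t', r', eta', xi', zeta') := w in
  dot x x' + dot s s' + dot v v' + dot t t' + dot r r' + dot eta eta' +
  dot xi xi' + dot zeta zeta'.

Definition Top (R : realType) d n m l q p (A : 'M[R]_(d, n)) (y : 'cV[R]_d)
    (L : 'M[R]_(m, n)) (B : 'M[R]_(q, m)) (M : 'M[R]_(p, l)) (lam : R)
    (C : set 'cV[R]_n) (f : 'cV[R]_(m + l) -> \bar R) (g : 'cV[R]_p -> \bar R)
    (gam1 gam2 gam3 gam4 : R) (z : Hspace R n m l p) : Hspace R n m l p :=
  let: (x, s, v, t, r, eta, xi, zeta) := z in
  let x' := proj C (x - gam1 *: (Qmx A L B lam *m x - A^T *m y
                                 + lam *: (L^T *m B^T *m B *m v)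
                                 + lam *: (L^T *m r))) in
  let s' := s - gam2 *: (eta + M^T *m xi) in
  let vt' := prox (escale gam3 f)
    (col_mx (v + gam3 *: (B^T *m B *m (L *m (2 *: x' - x) - v)))
            (t - gam3 *: (M^T *m zeta))) in
  let v' := usubmx vt' in
  let t' := dsubmx vt' in
  let re' := prox (conjugate f)
    (col_mx (r + L *m (2 *: x' - x)) (eta + 2 *: s' - s)) in
  let r' := usubmx re' in
  let eta' := dsubmx re' in
  let xi' := prox (conjugate g) (xi + M *m (2 *: s' - s)) in
  let zeta' := prox (escale gam4 (conjugate g))
    (zeta + gam4 *: (M *m (2 *: t' - t))) in
  (x', s', v', t', r', eta', xi', zeta').

Definition Pop (R : realType) n m l q p (L : 'M[R]_(m, n)) (B : 'M[R]_(q, m))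
    (M : 'M[R]_(p, l)) (lam gam1 gam2 gam3 gam4 : R)
    (z : Hspace R n m l p) : Hspace R n m l p :=
  let: (x, s, v, t, r, eta, xi, zeta) := z in
  (gam1^-1 *: x - lam *: (L^T *m B^T *m B *m v) - lam *: (L^T *m r),
   (lam / gam2) *: s - lam *: eta - lam *: (M^T *m xi),
   (lam / gam3) *: v - lam *: (B^T *m B *m L *m x),
   (lam / gam3) *: t - lam *: (M^T *m zeta),
   lam *: r - lam *: (L *m x),
   lam *: eta - lam *: s,
   lam *: xi - lam *: (M *m s),
   (lam / gam4) *: zeta - lam *: (M *m t)).

Definition posdefop (R : realType) (V : lmodType R) (ip : V -> V -> R)
    (P : V -> V) : Prop :=
  [/\ linear P, forall z w, ip (P z) w = ip z (P w)
    & forall z, z != 0 -> 0 < ip z (P z)].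

Definition weighted_ip (R : realType) (V : lmodType R) (ip : V -> V -> R)
    (P : V -> V) (z w : V) : R := ip z (P w).

Definition ip_norm (R : realType) (V : lmodType R) (ip : V -> V -> R) (z : V)
    : R := Num.sqrt (ip z z).

Definition nonexpansive (R : realType) (V : lmodType R) (nrm : V -> R)
    (T : V -> V) : Prop :=
  forall z w, nrm (T z - T w) <= nrm (z - w).

Definition averaged (R : realType) (V : lmodType R) (nrm : V -> R) (alpha : R)
    (T : V -> V) : Prop :=
  0 < alpha < 1 /\
  exists N : V -> V, nonexpansive nrm N /\
    forall z, T z = (1 - alpha) *: z + alpha *: N z.

Definition Fix (V : Type) (T : V -> V) : set V := [set z | T z = z].

(* Main.v *)
(* The map T is a forward-backward step in the metric of P: it splits a maximally
   monotone operator from the cocoercive gradient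
   z |-> (Q x - A^T y, 0, lam B^T B v, 0, ...).  Reading every prox as a subgradient
   inclusion (through Moreau's decomposition for the conjugates), one step of T
   becomes a system of inclusions, affine in the old and the new point.
   Monotonicity of the subdifferentials and P >= (kappa / 2) diag(Q, lam B^T B) give
   averagedness, and the Krasnoselskii-Mann argument gives convergence.

   At a fixed point, r is a subgradient of psi at L x, and v minimises
   psi + 1/2 |B (L x - .)|^2, which makes x stationary, hence optimal, for the convex
   function J.  Conversely, let x be optimal.  The symmetry of phi forces the infimum
   defining the envelope of psi to be attained, at v say; the first order condition at
   v yields an affine minorant of the envelope, hence the upper bound
     J z - J x <= <c, z - x> + lam (psi (L z) - psi (L x)) + 1/2 |A (z - x)|^2
   with c = Q x - A^T y + lam L^T B^T B v, so that x also minimises the first two terms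
   over C.  The multipliers r, xi and zeta then come from the sum rule for
   subdifferentials under the relative interior conditions, which rests on the
   finite-dimensional Hahn-Banach theorem. *)
Require Import Defs.
From HB Require Import structures.
From mathcomp Require Import all_boot all_order all_algebra.
From mathcomp Require Import all_classical all_reals all_analysis.
From mathcomp Require Import ring lra.

Set Implicit Arguments.
Unset Strict Implicit.
Unset Printing Implicit Defensive.

Import Order.TTheory GRing.Theory Num.Theory.
Import numFieldNormedType.Exports.

Local Open Scope classical_set_scope.
Local Open Scope ring_scope.

(** * Euclidean spaces *)

Section euclid.
Variable R : realType.

(** The condition Q >= 0 balances curvatures: - lam env (L x) is a supremum of concave quadratics
    with Hessian - lam L^T B^T B L, and 1/2 |y - A x|^2 makes up exactly for it. Convexity of J
    enters only as the inequality <e, Q e> >= 0. Attainment of the envelope is the delicate point: B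
    may have a kernel, so phi + 1/2 |B (u - .)|^2 need not be coercive and a minimising sequence may
    escape to infinity. The symmetry of phi makes every direction of escape reversible. The constant
    kappa / (2 kappa - 1) is the usual one for a forward-backward step. The gradient part D =
    diag(Q, lam B^T B) satisfies D <= (2 / kappa) P, so it is beta-cocoercive with beta = kappa / 2
    in the metric of P, and such a step is averaged with constant 1 / (2 - 1 / (2 beta)). Convex
    functions are handled through their finite values, limits are taken along a single ultrafilter
    in place of nested subsequences, and the geometry of [dot] is tied to the max norm topology by
    [normr_le_enorm] and [dot_le_normr]. *)

Lemma ler_mx_norm m n (A : 'M[R]_(m, n)) i j : `|A i j| <= `|A|.
Proof.
by rewrite [leRHS]/Num.Def.normr/= mx_normrE; apply/bigmax_geP; right; exists (i, j).
Qed.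

Lemma mx_norm_le m n (A : 'M[R]_(m, n)) e :
  0 <= e -> (forall i j, `|A i j| <= e) -> `|A| <= e.
Proof.
move=> e0 Ae; rewrite [leLHS]/Num.Def.normr/= mx_normrE.
by apply/bigmax_leP; split=> // -[i j] _ /=; exact: Ae.
Qed.

Section dot.
Variable N : nat.
Implicit Types (u v w : 'cV[R]_N) (a : R).

Lemma dotE u v : dot u v = \sum_i u i 0 * v i 0.
Proof. by rewrite /dot mxE; apply: eq_bigr => i _; rewrite mxE. Qed.

Lemma dotC u v : dot u v = dot v u.
Proof. by rewrite !dotE; apply: eq_bigr => i _; rewrite mulrC. Qed.

Lemma dotDl u v w : dot (u + v) w = dot u w + dot v w.
Proof. by rewrite /dot linearD mulmxDl mxE. Qed.

Lemma dotZl a u v : dot (a *: u) v = a * dot u v.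
Proof. by rewrite /dot linearZ -scalemxAl mxE. Qed.

Lemma dotDr u v w : dot u (v + w) = dot u v + dot u w.
Proof. by rewrite !(dotC u) dotDl. Qed.

Lemma dotZr a u v : dot u (a *: v) = a * dot u v.
Proof. by rewrite !(dotC u) dotZl. Qed.

Lemma dotNl u v : dot (- u) v = - dot u v.
Proof. by rewrite -scaleN1r dotZl mulN1r. Qed.

Lemma dotNr u v : dot u (- v) = - dot u v.
Proof. by rewrite !(dotC u) dotNl. Qed.

Lemma dotBl u v w : dot (u - v) w = dot u w - dot v w.
Proof. by rewrite dotDl dotNl. Qed.

Lemma dotBr u v w : dot u (v - w) = dot u v - dot u w.
Proof. by rewrite dotDr dotNr. Qed.

Lemma dot0l u : dot 0 u = 0.
Proof. by rewrite -(scale0r u) dotZl mul0r. Qed.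

Lemma dot0r u : dot u 0 = 0.
Proof. by rewrite dotC dot0l. Qed.

Lemma dot_ge0 u : 0 <= dot u u.
Proof. by rewrite dotE sumr_ge0// => i _; rewrite -expr2 sqr_ge0. Qed.

Lemma dot_eq0 u : (dot u u == 0) = (u == 0).
Proof.
apply/eqP/eqP => [|->]; last exact: dot0l.
rewrite dotE => /psumr_eq0P u0; apply/colP => i; rewrite mxE; apply/eqP.
by rewrite -sqrf_eq0 expr2 u0// => j _; rewrite -expr2 sqr_ge0.
Qed.

Lemma dot_gt0 u : u != 0 -> 0 < dot u u.
Proof. by rewrite lt_neqAle dot_ge0 [0 == _]eq_sym dot_eq0 => ->. Qed.

Lemma enormK u : enorm u ^+ 2 = dot u u.
Proof. by rewrite sqr_sqrtr// dot_ge0. Qed.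

Lemma enorm_ge0 u : 0 <= enorm u.
Proof. exact: sqrtr_ge0. Qed.

Lemma ler_enorm u v : (enorm u <= enorm v) = (dot u u <= dot v v).
Proof. by rewrite ler_sqrt ?dot_ge0. Qed.

Lemma sqr_coord_le_dot u i : u i 0 ^+ 2 <= dot u u.
Proof.
rewrite dotE (bigD1 i)//= expr2 lerDl sumr_ge0// => j _.
by rewrite -expr2 sqr_ge0.
Qed.

Lemma normr_le_enorm u : `|u| <= enorm u.
Proof.
apply: mx_norm_le => [|i j]; first exact: enorm_ge0.
rewrite (ord1 j) -sqrtr_sqr ler_sqrt ?dot_ge0//.
exact: sqr_coord_le_dot.
Qed.

Lemma dot_le_normr u v : `|dot u v| <= N%:R * (`|u| * `|v|).
Proof.
rewrite dotE (le_trans (ler_norm_sum _ _ _))//.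
rewrite (@le_trans _ _ (\sum_(i < N) `|u| * `|v|))//.
  by apply: ler_sum => i _; rewrite normrM ler_pM// ler_mx_norm.
by rewrite sumr_const card_ord mulr_natl.
Qed.

End dot.

Lemma dot_mulmxl m n (K : 'M[R]_(m, n)) (u : 'cV_n) (v : 'cV_m) :
  dot (K *m u) v = dot u (K^T *m v).
Proof. by rewrite /dot trmx_mul mulmxA. Qed.

Lemma dot_mulmxr m n (K : 'M[R]_(m, n)) (u : 'cV_n) (v : 'cV_m) :
  dot v (K *m u) = dot (K^T *m v) u.
Proof. by rewrite dotC dot_mulmxl dotC. Qed.

Lemma dot_col_mx m l (u u' : 'cV[R]_m) (s s' : 'cV[R]_l) :
  dot (col_mx u s) (col_mx u' s') = dot u u' + dot s s'.
Proof. by rewrite /dot tr_col_mx mul_row_col mxE. Qed.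

Lemma dot_vsub m l (w w' : 'cV[R]_(m + l)) :
  dot w w' = dot (usubmx w) (usubmx w') + dot (dsubmx w) (dsubmx w').
Proof. by rewrite -dot_col_mx !vsubmxK. Qed.

Definition dot_lin := (dotDl, dotDr, dotNl, dotNr, dotZl, dotZr).

Lemma normr_trmx m n (A : 'M[R]_(m, n)) : `|A^T| = `|A|.
Proof.
suff H m' n' (B : 'M[R]_(m', n')) : `|B^T| <= `|B|.
  by apply/eqP; rewrite eq_le H -{1}[A]trmxK H.
by apply: mx_norm_le => // i j; rewrite mxE ler_mx_norm.
Qed.

Lemma linear_bounded_continuous (V W : normedModType R) (f : {linear V -> W})
  (c : R) : (forall x, `|f x| <= c * `|x|) -> continuous f.
Proof.
move=> fc x; apply/cvgrPdist_le => e e0.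
have c0 : 0 < `|c| + 1 by rewrite ltr_wpDl.
have : \forall z \near x, `|x - z| <= e / (`|c| + 1).
  by apply: cvgr_dist_le; [exact: cvg_id|rewrite divr_gt0].
apply: filterS => z; rewrite ler_pdivlMr// => h; rewrite -linearB.
rewrite (le_trans (fc _))// (le_trans _ h)// mulrC ler_wpM2l//.
by rewrite (le_trans (ler_norm _))// lerDl.
Qed.

Lemma trmx_continuous m n : continuous (@trmx R m n).
Proof.
apply: (@linear_bounded_continuous _ _ (@trmx R m n : {linear _ -> _}) 1) => A.
by rewrite mul1r normr_trmx.
Qed.

(** Heine-Borel for row vectors, carried over by the continuous map [trmx]. *)
Lemma compact_ball_cV N (r : R) : compact [set u : 'cV[R]_N | `|u| <= r].
Proof.
have -> : [set u : 'cV[R]_N | `|u| <= r] =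
    trmx @` [set v : 'rV[R]_N | `|v| <= r].
  apply/seteqP; split=> [u ur|_ [v vr <-]]; last by rewrite /= normr_trmx.
  by exists u^T; rewrite ?trmxK//= normr_trmx.
apply: continuous_compact.
  by apply: continuous_subspaceT => ?; exact: trmx_continuous.
apply: bounded_closed_compact.
  by exists r; split=> [|x rx v /= vr]; [exact: num_real|exact: (le_trans vr (ltW _))].
rewrite (_ : [set _ | _] = Num.Def.normr @^-1` [set t : R | t <= r])//.
by apply: closed_comp => [v _|]; [exact: norm_continuous|exact: closed_le].
Qed.

Lemma mulmx_bounded m n (K : 'M[R]_(m, n)) :
  exists2 c : R, 0 <= c & forall u : 'cV[R]_n, `|K *m u| <= c * `|u|.
Proof.
exists (n%:R * `|K|); first by rewrite mulr_ge0.
move=> u; apply: mx_norm_le => [|i j]; first by rewrite !mulr_ge0.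
rewrite mxE (le_trans (ler_norm_sum _ _ _))//.
rewrite (@le_trans _ _ (\sum_(i < n) `|K| * `|u|))//.
  by apply: ler_sum => k _; rewrite normrM ler_pM// ler_mx_norm.
by rewrite sumr_const card_ord -mulrA mulr_natl.
Qed.

Lemma mulmx_continuous m n (K : 'M[R]_(m, n)) :
  continuous (fun u : 'cV[R]_n => K *m u).
Proof.
have [c _ Kc] := mulmx_bounded K.
exact: (linear_bounded_continuous (f := mulmx K) Kc).
Qed.

Lemma dot_cvg N (T : Type) (F : set_system T) {FF : Filter F}
    (u v : T -> 'cV[R]_N) (a b : 'cV[R]_N) :
  u @ F --> a -> v @ F --> b -> dot (u x) (v x) @[x --> F] --> dot a b.
Proof.
have coord (w : T -> 'cV[R]_N) (c : 'cV[R]_N) i : w @ F --> c -> w x i 0 @[x --> F] --> c i 0.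
  move=> /cvgrPdist_le wc; apply/cvgrPdist_le => e e0.
  apply: filterS (wc _ e0) => x; apply: le_trans.
  by have := ler_mx_norm (c - w x) i 0; rewrite !mxE.
move=> ua vb; rewrite dotE.
under eq_fun do rewrite dotE.
by apply: cvg_big => [|i _]; [exact: add_continuous|apply: cvgM; exact: coord].
Qed.

End euclid.

(** * Lower semicontinuity and convexity *)

Section lsc.
Variable R : realType.
Local Open Scope ereal_scope.

Lemma ereal_between (a b : \bar R) : a != -oo -> a < b ->
  exists2 c : R, a < c%:E & c%:E < b.
Proof.
case: a => [a| |]// _; case: b => [b| |]//.
- rewrite lte_fin => ab; exists ((a + b) / 2)%R; rewrite lte_fin; lra.
- by exists (a + 1)%R; rewrite ?ltry// lte_fin ltrDl.
Qed.

Lemma fin_of_le (a : \bar R) (b : R) : a != -oo -> a <= b%:E ->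
  exists2 c : R, a = c%:E & (c <= b)%R.
Proof. by case: a => [a| |]// _; rewrite lee_fin; exists a. Qed.

Lemma lsc_addr_continuous (T : topologicalType) (f : T -> \bar R) (h : T -> R) :
  lower_semicontinuous f -> continuous h ->
  lower_semicontinuous (fun x => f x + (h x)%:E).
Proof.
move=> lf ch x a; rewrite -lteBlDr// -EFinB => /ereal_between[//|c hc /lf[V xV Vf]].
(* The level a is split as c + (a - c): near x, f stays above c and h above a - c. *)
have : \forall y \near x, (a - c < h y)%R.
  move: hc; rewrite lte_fin ltrBlDr addrC -ltrBlDr => hc.
  by apply: (cvgr_gt (h x)) => //; exact: ch.
move=> hV; exists (V `&` [set y | (a - c < h y)%R]); first exact: filterI.
move=> y [/Vf cf /= hy]; rewrite (_ : a = c + (a - c))%R; last by rewrite addrC subrK.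
by rewrite EFinD lteD// lte_fin.
Qed.

(** The sublevel sets [B y] are totally ordered by inclusion, hence form a filter base; by
    compactness it has a cluster point, and lower semicontinuity makes any cluster point a
    minimiser. *)
Lemma lsc_attains_compact (T : topologicalType) (A : set T) (f : T -> \bar R) :
  compact A -> A !=set0 -> lower_semicontinuous f -> (forall x, f x != -oo) ->
  exists2 x, A x & forall y, A y -> f x <= f y.
Proof.
move=> cA [x0 Ax0] lf fN.
pose B y := [set x | A x /\ f x <= f y].
have FF : ProperFilter (filter_from A B).
  apply: filter_from_proper; last by move=> y Ay; exists y; split.
  apply: filter_from_filter; first by exists x0.
  move=> x y Ax Ay; have [xy|/ltW yx] := leP (f x) (f y).
    by exists x => // z [Az zx]; split; split=> //; exact: le_trans xy.
  by exists y => // z [Az zy]; split; split=> //; exact: le_trans yx.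
have [|x [Ax clx]] := cA _ FF; first by exists x0 => // z [].
exists x => // y Ay; rewrite leNgt; apply/negP => /ereal_between[//|a ya /lf[V xV Vf]].
have [|z [[_ zy] /Vf]] := clx (B y) V _ xV; first by exists y.
by rewrite ltNge (le_trans zy (ltW ya)).
Qed.

Lemma lsc_attains N (f : 'cV[R]_N -> \bar R) x0 (r : R) :
  lower_semicontinuous f -> (forall x, f x != -oo) ->
  (forall x, (r < `|x|)%R -> f x0 < f x) ->
  exists x, forall y, f x <= f y.
Proof.
move=> lf fN fr.
have [|x _ xm] := lsc_attains_compact (@compact_ball_cV R N r) _ lf fN.
  by exists x0; rewrite /= leNgt; apply/negP => /fr; rewrite ltxx.
exists x => y; have [/xm//|/fr yr] := leP `|y|%R r.
apply: le_trans (ltW yr); apply: xm.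
by rewrite /= leNgt; apply/negP => /fr; rewrite ltxx.
Qed.

Lemma lsc_le_lim (T : topologicalType) (I : Type) (F : set_system I)
    {FF : ProperFilter F} (f : T -> \bar R) (u : I -> T) (b : I -> R) x (l : R) :
  lower_semicontinuous f -> u @ F --> x -> b @ F --> l ->
  (\forall i \near F, f (u i) <= (b i)%:E) -> f x <= l%:E.
Proof.
move=> lf ux bl fb; rewrite leNgt; apply/negP => /ereal_between[//|c lc /lf[V xV Vf]].
have uV : \forall i \near F, V (u i) by exact: ux.
have bc : \forall i \near F, (b i < c)%R by apply: (cvgr_lt l).
have [i [[/Vf Vi fi] bi]] := filter_ex (filterI (filterI uV fb) bc).
by move: Vi; rewrite ltNge (le_trans fi)// lee_fin ltW.
Qed.

End lsc.

Section convex.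
Variable R : realType.

(** Divide by t and let t tend to 0. First order conditions are derived this way, by testing a
    minimum along a segment, without derivatives. *)
Lemma ge0_of_quadratic (a b : R) :
  (forall t, 0 < t < 1 -> 0 <= t * a + t ^+ 2 * b) -> 0 <= a.
Proof.
move=> H; rewrite leNgt; apply/negP => a0.
(* For this t one has t |b| < - a, so the quadratic term cannot make up for a negative linear
   one. *)
pose t := (- a) / (- a + `|b| + 1).
have d0 : 0 < - a + `|b| + 1 by have := normr_ge0 b; lra.
have t01 : 0 < t < 1.
  rewrite divr_gt0 ?oppr_gt0//= ltr_pdivrMr// mul1r.
  by have := normr_ge0 b; lra.
have := H _ t01; rewrite expr2 -mulrA -mulrDr pmulr_rge0; last by case/andP: t01.
have : t * b <= t * `|b| by rewrite ler_pM2l ?ler_norm//; case/andP: t01.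
have : t * (- a + `|b| + 1) = - a by rewrite mulfVK// gt_eqF.
case/andP: t01 => t0 _; have := normr_ge0 b; nra.
Qed.

(* For functions that never take the value -oo, testing z only where f is finite is
   the usual subgradient inequality. *)
Definition subgrad N (f : 'cV[R]_N -> \bar R) (x w : 'cV[R]_N) : Prop :=
  exists2 a, f x = a%:E &
    forall z b, f z = b%:E -> a + dot w (z - x) <= b.

Lemma subgrad_mono N (f : 'cV[R]_N -> \bar R) x w x' w' :
  subgrad f x w -> subgrad f x' w' -> 0 <= dot (w - w') (x - x').
Proof.
move=> [a fx fxw] [a' fx' fxw'].
have := fxw _ _ fx'; have := fxw' _ _ fx; rewrite !dot_lin; lra.
Qed.

Lemma econvex_fin (V : lmodType R) (f : V -> \bar R) x z (a b t : R) :
  (forall x, f x != -oo%E) -> econvex f -> 0 < t < 1 ->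
  f x = a%:E -> f z = b%:E ->
  exists2 c, f (t *: x + (1 - t) *: z) = c%:E & c <= t * a + (1 - t) * b.
Proof.
move=> fN fc t01 fx fz; apply: fin_of_le => //.
by have := fc x z t t01; rewrite fx fz -!EFinM -EFinD.
Qed.

Section quadratic_perturbation.
Variables (N q : nat) (f : 'cV[R]_N -> \bar R) (K : 'M[R]_(q, N)) (k : 'cV[R]_q).

Lemma subgrad_of_min (c : R) p a :
  (forall x, f x != -oo%E) -> econvex f -> f p = a%:E ->
  (forall z b, f z = b%:E ->
     a + c / 2 * dot (k - K *m p) (k - K *m p) <=
     b + c / 2 * dot (k - K *m z) (k - K *m z)) ->
  subgrad f p (c *: (K^T *m (k - K *m p))).
Proof.
move=> fN fc fp pmin; exists a => // z b fz.
rewrite -subr_ge0; apply: (@ge0_of_quadratic _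
  (c / 2 * dot (K *m (z - p)) (K *m (z - p)))) => t t01.
have [a' fa' a'le] := econvex_fin fN fc t01 fz fp.
have := pmin _ _ fa'.
rewrite (_ : k - K *m (t *: z + (1 - t) *: p) =
             (k - K *m p) - t *: (K *m (z - p))); last first.
  rewrite mulmxDr -!scalemxAr mulmxBr scalerBl scale1r scalerBr.
  by rewrite !opprD !opprK addrA addrA; do ?rewrite -!addrA; congr (_ + _);
     rewrite addrCA.
rewrite dotZl dot_mulmxl trmxK.
move: (k - K *m p) (K *m (z - p)) => e h.
rewrite !(dotBl, dotBr, dotZl, dotZr) (dotC h e) expr2; nra.
Qed.

End quadratic_perturbation.

End convex.

Section convex_tools.
Variable R : realType.

Lemma convex_setP N (C : set 'cV[R]_N) x z (t : R) : convex_set C ->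
  0 < t < 1 -> C x -> C z -> C (t *: x + (1 - t) *: z).
Proof.
move=> Cc /andP[/ltW t0 /ltW t1] /mem_set Cx /mem_set Cz.
by have := Cc _ _ (Itv01 t0 t1) Cx Cz; rewrite inE.
Qed.

Lemma lsc_comp (S T : topologicalType) (f : T -> \bar R) (h : S -> T) :
  lower_semicontinuous f -> continuous h -> lower_semicontinuous (f \o h).
Proof.
move=> lf ch x a /lf[V hV Vf]; exists (h @^-1` V); first exact: ch hV.
by move=> y /Vf.
Qed.

(** Replacing t by its inverse turns growth at infinity into the behaviour at 0 treated by
    [ge0_of_quadratic]. *)
Lemma le0_of_quadratic (al be ga : R) :
  (forall t, 0 <= t -> t ^+ 2 * al <= be + t * ga) -> al <= 0.
Proof.
move=> H; rewrite -oppr_ge0; apply: (@ge0_of_quadratic _ _ (`|be| + `|ga|)).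
move=> t /andP[t0 t1]; have tV : 0 <= t^-1 by rewrite invr_ge0 ltW.
have ts : t * t^-1 = 1 by rewrite mulfV// gt_eqF.
have := H _ tV; move: (t^-1) ts => s ts; rewrite expr2 => h.
have {h} : t * t * (s * s * al) <= t * t * (be + s * ga).
  by rewrite ler_wpM2l// mulr_ge0// ltW.
have -> : t * t * (s * s * al) = (t * s) * (t * s) * al by ring.
have -> : t * t * (be + s * ga) = t * t * be + (t * s) * (t * ga) by ring.
rewrite ts !mul1r => h.
have hb : t * t * be <= t * `|be|.
  by rewrite -mulrA ler_wpM2l ?(ltW t0)// (le_trans (ler_norm _))// normrM gtr0_norm// ler_piMl// ltW.
have hg : t * ga <= t * `|ga| by rewrite ler_wpM2l ?ler_norm// ltW.
have : t * al <= t * (t * (`|be| + `|ga|)) by rewrite ler_wpM2l ?(ltW t0)//; lra.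
by rewrite expr2; lra.
Qed.

End convex_tools.

(** * Proximity operators and projections *)

Section prox.
Variable R : realType.

Lemma Gamma0_NNy N (f : 'cV[R]_N -> \bar R) : Gamma0 f -> forall x, f x != -oo%E.
Proof. by case=> -[]. Qed.

Lemma Gamma0_fin N (f : 'cV[R]_N -> \bar R) : Gamma0 f -> exists x a, f x = a%:E.
Proof.
case=> -[fN [x]]; rewrite /dom/= => fx _ _; exists x.
by move: (fN x) fx; case: (f x) => // a _ _; exists a.
Qed.

(** An elementary substitute for an affine minorant. The minimum mu of f over a ball containing the
    unit ball about x0 controls the slope along every ray from x0: pulling x back to the unit sphere
    about x0 and using convexity gives D = b0 - mu. *)
Lemma econvex_lower_growth N (f : 'cV[R]_N -> \bar R) x0 b0 :
  Gamma0 f -> f x0 = b0%:E ->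
  exists2 D : R, 0 <= D &
    forall x b, f x = b%:E -> b0 - D - D * `|x - x0| <= b.
Proof.
move=> fG fx0; have fN := Gamma0_NNy fG; case: fG => _ lf fc.
have [|x _ xm] := lsc_attains_compact (@compact_ball_cV R N (`|x0| + 1)) _ lf fN.
  by exists x0; rewrite /= lerDl.
have [|mu fx mule] := fin_of_le (b := b0) (fN x).
  by rewrite -fx0; apply: xm; rewrite /= lerDl.
have {}xm z b : `|z| <= `|x0| + 1 -> f z = b%:E -> mu <= b.
  by move=> /xm; rewrite fx => + fz; rewrite fz lee_fin.
exists (b0 - mu) => [|z b fz]; first by rewrite subr_ge0.
have [z1|z1] := leP `|z - x0| 1.
  have : mu <= b.
    apply: xm fz; rewrite -[z](subrK x0) (le_trans (ler_normD _ _))//.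
    by rewrite addrC lerD2l.
  have : 0 <= (b0 - mu) * `|z - x0| by rewrite mulr_ge0// subr_ge0.
  lra.
set t := `|z - x0| in z1 *.
have t01 : 0 < t^-1 < 1 by rewrite invr_gt0 invf_lt1 ?(lt_trans ltr01).
have [c fc' cle] := econvex_fin fN fc t01 fz fx0.
have : mu <= c.
  apply: xm fc'.
  rewrite (_ : _ + _ = x0 + t^-1 *: (z - x0)); last first.
    by rewrite scalerBl scale1r scalerBr addrCA addrA.
  rewrite (le_trans (ler_normD _ _))// lerD2l normrZ ger0_norm; last first.
    by case/andP: t01 => /ltW.
  by rewrite mulVf// gt_eqF// (lt_trans ltr01).
move=> /le_trans /(_ cle); rewrite -(ler_pM2l (lt_trans ltr01 z1)).
rewrite mulrDr !mulrA mulrBr mulfV ?gt_eqF// ?(lt_trans ltr01)// mulr1 mul1r; nra.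
Qed.

Lemma sqnorm_perturb_attains N (f : 'cV[R]_N -> \bar R) (c : R) x :
  Gamma0 f -> 0 < c ->
  exists p a, f p = a%:E /\ forall z b, f z = b%:E ->
    a + c * dot (x - p) (x - p) <= b + c * dot (x - z) (x - z).
Proof.
move=> fG c0; have fN := Gamma0_NNy fG; have [x0 [b0 fx0]] := Gamma0_fin fG.
have [D D0 fD] := econvex_lower_growth fG fx0.
pose h z := c * dot (x - z) (x - z).
pose F z := (f z + (h z)%:E)%E.
have FN z : F z != -oo%E.
  by rewrite /F; move: (fN z); case: (f z).
have lF : lower_semicontinuous F.
  apply: lsc_addr_continuous; first by case: fG.
  move=> z; apply: (@cvgM R _ (nbhs z) _ (fun=> c)); first exact: cvg_cst.
  by apply: dot_cvg; apply: cvgB => //; exact: cvg_cst.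
pose s := `|x - x0|; pose H := D * s + D + h x0.
have h0 z : 0 <= h z by rewrite /h mulr_ge0 ?dot_ge0// ltW.
have s0 : 0 <= s by exact: normr_ge0.
have H0 : 0 <= H by apply: addr_ge0 (h0 _); apply: addr_ge0 => //; exact: mulr_ge0.
have K0 : 0 <= (D + H) / c by exact: divr_ge0 (addr_ge0 D0 H0) (ltW c0).
(* Beyond this radius u = |z - x0| - s satisfies u >= 1 and c u > D + H, so c u^2 exceeds D u + H,
   which is all that the lower bound on f can lose plus h x0. The extra [|x0|] below recentres the
   ball at 0. *)
pose r := s + 1 + (D + H) / c.
have [|p pm] := @lsc_attains _ _ F x0 (r + `|x0|) lF FN.
  move=> z zr; rewrite /F fx0 -EFinD; case fz: (f z) => [b| |]; last 2 first.
  - by rewrite ltry.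
  - by move: (fN z); rewrite fz.
  rewrite -EFinD lte_fin; apply: lt_le_trans (lerD (fD _ _ fz) (lexx _)).
  set t := `|z - x0|.
  have rt : r < t by have := ler_normD (z - x0) x0; rewrite subrK -/t; lra.
  have hz : c * (t - s) ^+ 2 <= h z.
    rewrite /h ler_wpM2l ?(ltW c0)// -enormK.
    have ts : t - s <= enorm (x - z).
      apply: le_trans (normr_le_enorm _).
      rewrite lerBlDr /t /s -(normrN (x - z)) opprB.
      by rewrite (le_trans _ (ler_normD _ _))// addrA subrK.
    rewrite ler_pXn2r ?nnegrE ?enorm_ge0//.
    rewrite subr_ge0 (le_trans _ (ltW rt))// /r -addrA lerDl.
    exact: addr_ge0.
  have u1 : 1 <= t - s by move: rt K0; rewrite /r; lra.
  have cu : D + H < c * (t - s).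
    rewrite mulrC -ltr_pdivrMr//; move: rt; rewrite /r; lra.
  move: hz cu u1 H0; rewrite /H; set u := t - s.
  have -> : t = u + s by rewrite /u subrK.
  rewrite expr2 => hz cu u1 H0; nra.
have [|a Fp ale] := fin_of_le (b := b0 + h x0) (FN p).
  by have := pm x0; rewrite {2}/F fx0.
have [a' fp _] : exists2 a', f p = a'%:E & True.
  by move: Fp (fN p); rewrite /F; case: (f p) => [a'| |]// _ _; exists a'.
exists p, a'; split => // z b fz.
by have := pm z; rewrite /F fz fp -!EFinD lee_fin.
Qed.

Lemma subgrad_resolvent N (f : 'cV[R]_N -> \bar R) (gam : R) x :
  Gamma0 f -> 0 < gam ->
  exists p, subgrad f p (gam^-1 *: (x - p)).
Proof.
move=> fG g0; have c0 : 0 < gam^-1 / 2 by rewrite divr_gt0 ?invr_gt0.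
have [p [a [fp pm]]] := sqnorm_perturb_attains x fG c0.
exists p; have [_ _ fc] := fG.
have := @subgrad_of_min _ N N f 1%:M x gam^-1 p a (Gamma0_NNy fG) fc fp.
by rewrite trmx1 !mul1mx; apply => z b fz; rewrite mul1mx; exact: pm.
Qed.

Lemma prox_subgrad N (f : 'cV[R]_N -> \bar R) (gam : R) x p :
  0 < gam -> (forall x, f x != -oo%E) ->
  subgrad f p (gam^-1 *: (x - p)) -> prox (escale gam f) x = p.
Proof.
move=> g0 fN [a fp pm]; rewrite /prox.
set h := fun z => _.
(* The margin 1/2 |z - p|^2 comes from strong convexity. It gives minimality of p and also
   uniqueness, which determines the point chosen by [xget]. *)
have key z b : f z = b%:E ->
    gam * a + 2^-1 * dot (x - p) (x - p) + 2^-1 * dot (z - p) (z - p)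
    <= gam * b + 2^-1 * dot (x - z) (x - z).
  move=> /pm; rewrite -(ler_pM2l g0) dotZl mulrDr mulrA mulfV ?gt_eqF// mul1r.
  rewrite (_ : x - z = (x - p) - (z - p)); last by rewrite opprB addrA subrK.
  move: (x - p) (z - p) => u v; rewrite !(dotBl, dotBr) (dotC v u); lra.
have hp : h p = (gam * a + 2^-1 * dot (x - p) (x - p))%:E.
  by rewrite /h/escale fp enormK.
have hm z : (h p + (2^-1 * dot (z - p) (z - p))%:E <= h z)%E.
  rewrite hp /h/escale enormK.
  case fz : (f z) => [b| |]; last by move: (fN z); rewrite fz.
    by rewrite -EFinM -!EFinD lee_fin; exact: key.
  by rewrite gt0_muley ?lte_fin// leey.
have pmin : argmin setT h p.
  split=> // z _; apply: le_trans (hm z).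
  by rewrite hp -EFinD lee_fin lerDl mulr_ge0 ?invr_ge0// dot_ge0.
apply: (@xget_subset1 _ _ (argmin setT h)) => // z w [_ zm] [_ wm].
suff H v : (forall u, setT u -> (h v <= h u)%E) -> v = p by rewrite (H z) // (H w).
move=> vm; have := le_trans (hm v) (vm p I); rewrite hp -EFinD lee_fin gerDl.
rewrite pmulr_rle0 ?invr_gt0// => v0; apply/eqP; rewrite -subr_eq0 -dot_eq0.
by rewrite eq_le v0 dot_ge0.
Qed.

Lemma prox_escaleP N (f : 'cV[R]_N -> \bar R) (gam : R) x p :
  Gamma0 f -> 0 < gam ->
  prox (escale gam f) x = p <-> subgrad f p (gam^-1 *: (x - p)).
Proof.
move=> fG g0; split=> [<-|]; last by apply: prox_subgrad => //; exact: Gamma0_NNy.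
have [p' pP] := subgrad_resolvent x fG g0.
by rewrite (prox_subgrad g0 (Gamma0_NNy fG) pP).
Qed.

(** The equality case of the Fenchel-Young inequality: the supremum defining [conjugate f w] is
    reached at x. The proximity operators of conjugates are characterised from this implication and
    solvability of the resolvent inclusion for f, without passing through the biconjugate. *)
Lemma subgrad_conjugate N (f : 'cV[R]_N -> \bar R) x w :
  (forall x, f x != -oo%E) -> subgrad f x w -> subgrad (conjugate f) w x.
Proof.
move=> fN [a fx xw].
have cw : conjugate f w = (dot x w - a)%:E.
  apply/eqP; rewrite eq_le; apply/andP; split.
    apply: ge_ereal_sup => _ [z _ <-].
    case fz : (f z) => [b| |]; last by move: (fN z); rewrite fz.
      rewrite -EFinB lee_fin; have := xw _ _ fz.
      by rewrite dotBr (dotC w) (dotC w); lra.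
    by rewrite /= leNye.
  by apply: ereal_sup_ubound; exists x => //; rewrite fx.
exists (dot x w - a) => // u b cu.
have : ((dot x u - a)%:E <= conjugate f u)%E.
  by apply: ereal_sup_ubound; exists x => //; rewrite fx.
by rewrite cu lee_fin dotBr; lra.
Qed.

Lemma conjugate_NNy N (f : 'cV[R]_N -> \bar R) x : Gamma0 f ->
  conjugate f x != -oo%E.
Proof.
move=> /Gamma0_fin[z [a fz]]; rewrite gt_eqF//; apply: lt_le_trans (ltNyr (dot z x - a)) _.
by apply: ereal_sup_ubound; exists z => //; rewrite fz.
Qed.

(* Moreau's decomposition: prox_{gam f^*} x = x - gam prox_{f / gam} (x / gam) *)
Lemma prox_escale_conjugateP N (f : 'cV[R]_N -> \bar R) (gam : R) x w :
  Gamma0 f -> 0 < gam ->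
  prox (escale gam (conjugate f)) x = w <-> subgrad f (gam^-1 *: (x - w)) w.
Proof.
move=> fG g0; have gN0 : gam != 0 by rewrite gt_eqF.
have conjP u : subgrad f (gam^-1 *: (x - u)) u ->
    prox (escale gam (conjugate f)) x = u.
  move=> sub; apply: prox_subgrad => // [z|]; first exact: conjugate_NNy.
  by apply: subgrad_conjugate => //; exact: Gamma0_NNy.
split=> [<-|]; last exact: conjP.
have gV0 : 0 < gam^-1 by rewrite invr_gt0.
have [p] := subgrad_resolvent (gam^-1 *: x) fG gV0.
rewrite invrK scalerBr scalerA mulfV// scale1r => pP.
by rewrite (conjP (x - gam *: p)) subKr scalerA mulVf// scale1r.
Qed.

Lemma prox_conjugateP N (f : 'cV[R]_N -> \bar R) x w : Gamma0 f ->
  prox (conjugate f) x = w <-> subgrad f (x - w) w.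
Proof.
move=> fG; have := prox_escale_conjugateP x w fG (@ltr01 R).
rewrite invr1 scale1r (_ : escale 1 (conjugate f) = conjugate f)//.
by apply/funext => z; rewrite /escale mul1e.
Qed.

Section projection.
Variables (N : nat) (C : set 'cV[R]_N).
Hypotheses (C0 : C !=set0) (C_closed : closed C) (C_convex : convex_set C).

Definition indicator (z : 'cV[R]_N) : \bar R :=
  if z \in C then 0%E else +oo%E.

Lemma indicator_fin z b : indicator z = b%:E -> C z /\ b = 0.
Proof. by rewrite /indicator; case: ifPn => // /set_mem Cz [<-]. Qed.

Lemma indicatorE z : C z -> indicator z = 0%:E.
Proof. by move=> /mem_set Cz; rewrite /indicator Cz. Qed.

Lemma indicator_Gamma0 : Gamma0 indicator.
Proof.
split.
- split; first by move=> z; rewrite /indicator; case: ifP.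
  by case: C0 => z Cz; exists z; rewrite /dom/= indicatorE// ltry.
- apply/lower_semicontinuousP => a; have [a0|a0] := ltP a 0.
    rewrite (_ : mkset _ = setT); first exact: openT.
    apply/seteqP; split=> // z _; rewrite /= /indicator; case: ifP => _.
      by rewrite lte_fin.
    by rewrite ltry.
  rewrite (_ : mkset _ = ~` C); first exact: closed_openC.
  apply/seteqP; split=> z /=; rewrite /indicator.
    by case: ifPn => [_|/negP zC _ /mem_set//]; rewrite lte_fin ltNge a0.
  by move=> Cz; rewrite ifF ?ltry//; apply/negP => /set_mem.
- move=> x z t t01; rewrite {2 3}/indicator; case/andP: (t01) => t0 t1.
  have t1' : 0 < 1 - t by rewrite subr_gt0.
  case: ifPn => [/set_mem Cx|_]; last first.
    rewrite gt0_muley ?lte_fin// addye ?leey//.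
    by case: ifPn; rewrite ?mule0// gt0_muley ?lte_fin.
  case: ifPn => [/set_mem Cz|_]; last by rewrite mule0 add0e gt0_muley ?lte_fin// leey.
  by rewrite !mule0 adde0 indicatorE//; exact: convex_setP.
Qed.

Lemma subgrad_indicatorP p w :
  subgrad indicator p w <-> C p /\ forall z, C z -> dot w (z - p) <= 0.
Proof.
split=> [[a /indicator_fin[Cp ->] sub]|[Cp sub]].
  by split=> // z /indicatorE /sub; rewrite add0r.
exists 0; first exact: indicatorE.
by move=> z b /indicator_fin[Cz ->]; rewrite add0r; exact: sub.
Qed.

(** The variational inequality gives a margin |z - p|^2 in the squared distance, hence uniqueness; a
    point satisfying it exists as the resolvent of [indicator]. *)
Lemma projP (x p : 'cV[R]_N) :
  Defs.proj C x = p <-> C p /\ forall z, C z -> dot (x - p) (z - p) <= 0.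
Proof.
have char q : C q -> (forall z, C z -> dot (x - q) (z - q) <= 0) -> Defs.proj C x = q.
  move=> Cq qP.
  have key z : C z -> dot (x - q) (x - q) + dot (z - q) (z - q) <= dot (x - z) (x - z).
    move=> /qP; rewrite (_ : x - z = (x - q) - (z - q)); last first.
      by rewrite opprB addrA subrK.
    by move: (x - q) (z - q) => u v; rewrite !(dotBl, dotBr) (dotC v u); lra.
  have qmin : argmin C (fun z => (enorm (x - z))%:E) q.
    split=> // z /key h; rewrite lee_fin ler_enorm (le_trans _ h)//.
    by rewrite lerDl dot_ge0.
  rewrite /Defs.proj; apply: (@xget_subset1 _ _ (argmin C _)) => // u v.
  suff H w : argmin C (fun z => (enorm (x - z))%:E) w -> w = q.
    by move=> /H -> /H ->.
  move=> [Cw /(_ _ Cq)]; rewrite lee_fin ler_enorm => /(le_trans (key _ Cw)).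
  rewrite gerDl => w0; apply/eqP; rewrite -subr_eq0 -dot_eq0.
  by rewrite eq_le w0 dot_ge0.
split=> [<-|[]]; last exact: char.
have [q /subgrad_indicatorP[]] := subgrad_resolvent x indicator_Gamma0 (@ltr01 R).
by rewrite invr1 scale1r => Cq qP; rewrite (char q).
Qed.

End projection.

End prox.

(** * The sum rule for subdifferentials *)

Section sum_rule.
Variable R : realType.

(** Hahn-Banach, one coordinate at a time. If p dominates xi on the vectors V supported on the first
    k coordinates, extending to the next basis vector e means choosing a value a above every xi d -
    p (d - e) and below every p (d + e) - xi d; subadditivity leaves room for it. *)
Lemma sublinear_support N (p : 'cV[R]_N -> R) :
  (forall u v, p (u + v) <= p u + p v) ->
  (forall t u, 0 < t -> p (t *: u) <= t * p u) ->
  exists xi, forall d, dot xi d <= p d.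
Proof.
move=> pD pZ.
have p0 : 0 <= p 0 by have := pD 0 0; rewrite addr0; lra.
suff /(_ N)[xi H] : forall k, exists xi, forall d : 'cV[R]_N,
    (forall i : 'I_N, (k <= i)%N -> d i 0 = 0) -> dot xi d <= p d.
  by exists xi => d; apply: H => i; rewrite leqNgt ltn_ord.
elim=> [|k [xi IH]].
  exists 0 => d d0; rewrite dot0l (_ : d = 0)//.
  by apply/colP => i; rewrite d0// mxE.
have [Nk|kN] := leqP N k.
  by exists xi => d _; apply: IH => i; rewrite leqNgt (leq_trans (ltn_ord i)).
pose i0 := Ordinal kN; pose e : 'cV[R]_N := delta_mx i0 0.
pose V (d : 'cV[R]_N) := forall i : 'I_N, (k <= i)%N -> d i 0 = 0.
have VZ t d : V d -> V (t *: d) by move=> Vd i /Vd; rewrite mxE => ->; rewrite mulr0.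
pose E := [set dot xi d - p (d - e) | d in V].
have Eub d : V d -> ubound E (p (d + e) - dot xi d).
  move=> Vd _ [d' Vd' <-]; rewrite lerBlDr addrAC lerBrDr -dotDr.
  have -> : p (d + e) + p (d' - e) = p (d' - e) + p (d + e) by rewrite addrC.
  apply: le_trans (pD _ _); rewrite addrACA addNr addr0.
  by apply: IH => i ki; rewrite mxE Vd'// Vd// addr0.
have V0 : V 0 by move=> i _; rewrite mxE.
have supE : has_sup E.
  by split; [exists (dot xi 0 - p (0 - e)), 0|exists (p (0 + e) - dot xi 0); exact: Eub].
pose a := sup E.
have ae d : V d -> dot xi d + a <= p (d + e).
  by move=> Vd; rewrite -lerBrDl; apply: ge_sup => //; [case: supE|exact: Eub].
have ea d : V d -> dot xi d - a <= p (d - e).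
  move=> Vd; rewrite lerBlDl -lerBlDr; apply: sup_upper_bound => //.
  by exists d.
have edot d : dot e d = d i0 0.
  rewrite dotE (bigD1 i0)//= big1 => [|i ii0]; rewrite mxE !eqxx/= ?mul1r ?addr0//.
  by rewrite (negPf ii0) mul0r.
(* The new functional takes the value a at e and is unchanged on V. Rescaling by the inverse of |t|
   reduces domination at d to [ae] or [ea], according to the sign of t. *)
exists (xi + (a - dot xi e) *: e) => d Vd.
pose t := d i0 0; pose d' := d - t *: e.
have d'i0 : d' i0 0 = 0 by rewrite !mxE !eqxx mulr1 subrr.
have Vd' : V d'.
  move=> i; rewrite leq_eqVlt => /orP[/eqP ki|ki].
    by rewrite (_ : i = i0)//; apply: val_inj.
  by rewrite !mxE Vd// (_ : i == i0 = false) ?mulr0 ?subr0// -val_eqE/= gtn_eqF.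
have dE : d = d' + t *: e by rewrite subrK.
have ed' : dot e d' = 0 by rewrite edot.
clearbody d'.
have ee : dot e e = 1 by rewrite edot mxE !eqxx.
have -> : dot (xi + (a - dot xi e) *: e) d = dot xi d' + t * a.
  by rewrite {1}dE dotDr !dotDl !dotZl !dotZr ed' ee; ring.
have [t0|t0|t0] := ltgtP t 0.
- have s0 : 0 < - t by rewrite oppr_gt0.
  have sV : 0 < (- t)^-1 by rewrite invr_gt0.
  have := le_trans (ea _ (VZ (- t)^-1 _ Vd')) _.
  move=> /(_ ((- t)^-1 * p d)).
  rewrite (_ : (- t)^-1 *: d' - e = (- t)^-1 *: d); last first.
    by rewrite [in RHS]dE scalerDr scalerA invrN mulNr mulVf ?scaleN1r// lt_eqF.
  move=> /(_ (pZ _ _ sV)); rewrite -(ler_pM2l s0) dotZr mulrBr !mulrA.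
  by rewrite mulfV ?gt_eqF// !mul1r mulNr opprK.
- have sV : 0 < t^-1 by rewrite invr_gt0.
  have := le_trans (ae _ (VZ t^-1 _ Vd')) _.
  move=> /(_ (t^-1 * p d)).
  rewrite (_ : t^-1 *: d' + e = t^-1 *: d); last first.
    by rewrite [in RHS]dE scalerDr scalerA mulVf ?scale1r// gt_eqF.
  move=> /(_ (pZ _ _ sV)); rewrite -(ler_pM2l t0) dotZr mulrDr !mulrA.
  by rewrite mulfV ?gt_eqF// !mul1r.
- by rewrite [in leRHS]dE t0 mul0r addr0 scale0r addr0; exact: IH.
Qed.

(** A finite family in Z whose span has maximal dimension spans all of Z. Since 0 is in Z, every
    linear combination becomes an affine one by giving the missing weight to 0; this lets the
    relative interior condition be applied to arbitrary directions after projecting. *)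
Lemma span_projection N (Z : set 'cV[R]_N) : Z 0 ->
  exists pi : {linear 'cV[R]_N -> 'cV[R]_N},
    (forall z, Z z -> pi z = z) /\ forall d, affine_hull Z (pi d).
Proof.
move=> Z0.
pose P k := `[< exists s : seq 'cV[R]_N,
                  (forall z, z \in s -> Z z) /\ \dim (span s) = k >].
have P0 : exists k, P k.
  by exists (\dim (span ([::] : seq 'cV[R]_N))); apply/asboolP; exists [::].
have Pb k : P k -> (k <= \dim {:'cV[R]_N})%N.
  by move=> /asboolP[s [_ <-]]; apply/dimvS/subvf.
case: (ex_maxnP P0 Pb) => k /asboolP[s [sZ sk]] kmax.
have Zs z : Z z -> z \in (span s).
  move=> Zz; have sub : (span s <= span (z :: s))%VS.
    by apply: sub_span => y ys; rewrite inE ys orbT.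
  have : (span s) == span (z :: s).
    rewrite eqEdim sub sk kmax//; apply/asboolP; exists (z :: s); split=> // y.
    by rewrite inE => /orP[/eqP ->//|/sZ].
  by move=> /eqP ->; apply: memv_span; rewrite mem_head.
exists (projv (span s)); split=> [z /Zs|d]; first exact: projv_id.
suff aff v : v \in span s -> affine_hull Z v by apply: aff; exact: memv_proj.
move=> vs.
have := coord_span (X := in_tuple s) vs; set c := coord _ => vE.
exists (size s).+1.
exists (fun i => if unlift ord0 i is Some j then c j v else 1 - \sum_j c j v).
exists (fun i => if unlift ord0 i is Some j then s`_j else 0); split.
- by move=> i; case: unlift => [j|//]; apply: sZ; rewrite mem_nth.
- rewrite big_ord_recl unlift_none.
  by under [X in _ + X]eq_bigr do rewrite liftK; rewrite subrK.
- rewrite big_ord_recl unlift_none scaler0 add0r {1}vE.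
  by apply: eq_bigr => j _; rewrite liftK.
Qed.

Section fenchel.
Variables (N q : nat) (F : 'cV[R]_N -> \bar R) (G : 'cV[R]_q -> \bar R).
Variables (K : 'M[R]_(q, N)) (x c : 'cV[R]_N) (a b : R).
Hypotheses (FN : forall w, F w != -oo%E) (GN : forall u, G u != -oo%E).
Hypotheses (Fc : econvex F) (Gc : econvex G) (Fx : F x = a%:E)
  (GKx : G (K *m x) = b%:E).
Hypothesis x_min : forall w a' b', F w = a'%:E -> G (K *m w) = b'%:E ->
  a + b + dot c (w - x) <= a' + b'.
Hypothesis ri0 : ri (set_sub (dom G) ((fun w => K *m w) @` dom F)) 0.

(* The graph of the value function z |-> inf_w F w + G (K w + z) - <c, w - x>,
   normalised to vanish at 0 *)
Let V z r := exists w u a' b',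
  [/\ F w = a'%:E, G u = b'%:E, z = u - K *m w &
      r = a' + b' - dot c (w - x) - (a + b)].

Let V0 r : V 0 r -> 0 <= r.
Proof.
move=> [w [u [a' [b' [Fw Gu /esym/eqP]]]]]; rewrite subr_eq0 => /eqP uE ->.
by rewrite uE in Gu; have := x_min Fw Gu; lra.
Qed.

Let V_convex z z' r r' t : 0 < t < 1 -> V z r -> V z' r' ->
  exists2 s, V (t *: z + (1 - t) *: z') s & s <= t * r + (1 - t) * r'.
Proof.
move=> t01 [w [u [a1 [b1 [Fw Gu -> ->]]]]] [w' [u' [a2 [b2 [Fw' Gu' -> ->]]]]].
have [a3 Fa a3le] := econvex_fin FN Fc t01 Fw Fw'.
have [b3 Gb b3le] := econvex_fin GN Gc t01 Gu Gu'.
exists (a3 + b3 - dot c (t *: w + (1 - t) *: w' - x) - (a + b)).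
  exists (t *: w + (1 - t) *: w'), (t *: u + (1 - t) *: u'), a3, b3; split=> //.
  by rewrite mulmxDr -!scalemxAr !scalerBr opprD addrACA.
by rewrite !(dotBr, dotDr, dotZr); nra.
Qed.

Let V_dom z : set_sub (dom G) ((fun w => K *m w) @` dom F) z -> exists r, V z r.
Proof.
move=> [u Gu [_ [w Fw <-] <-]].
move: Gu Fw; rewrite /dom/= => Gu Fw.
case Gub : (G u) => [b'| |]; [|by rewrite Gub in Gu|by have := GN u; rewrite Gub].
case Fwa : (F w) => [a'| |]; [|by rewrite Fwa in Fw|by have := FN w; rewrite Fwa].
by exists (a' + b' - dot c (w - x) - (a + b)), w, u, a', b'.
Qed.

Let dom_V z r : V z r -> set_sub (dom G) ((fun w => K *m w) @` dom F) z.
Proof.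
move=> [w [u [a' [b' [Fw Gu -> _]]]]]; exists u; first by rewrite /dom/= Gu ltry.
by exists (K *m w) => //; exists w => //; rewrite /dom/= Fw ltry.
Qed.

(** Difference quotients at 0 of the value function in direction d. Their infimum is the directional
    derivative, which is sublinear. *)
Let E d := [set e | exists t r, [/\ 0 < t, V (t *: d) r & e = t^-1 * r]].

Let E0 e : E 0 e -> 0 <= e.
Proof.
move=> [t [r [t0 + ->]]]; rewrite scaler0 => /V0 r0.
by apply: mulr_ge0 r0; rewrite invr_ge0 ltW.
Qed.

(** The points t d and t' d' are combined with weights t' / (t + t') and t / (t + t'), so that both
    directions receive the same step u = t t' / (t + t') and the sum is u (d + d'). *)
Let E_add d d' e e' : E d e -> E d' e' ->
  exists2 s, E (d + d') s & s <= e + e'.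
Proof.
move=> [t [r [t0 Vt ->]]] [t' [r' [t'0 Vt' ->]]].
have tt0 : 0 < t + t' by rewrite addr_gt0.
have l01 : 0 < t' / (t + t') < 1.
  by rewrite divr_gt0//= ltr_pdivrMr// mul1r ltrDr.
have lE : 1 - t' / (t + t') = t / (t + t').
  by field; rewrite gt_eqF.
have [s Vs sle] := V_convex l01 Vt Vt'; rewrite lE in Vs sle.
pose u := t * t' / (t + t').
have u0 : 0 < u by rewrite /u divr_gt0// mulr_gt0.
exists (u^-1 * s).
  exists u, s; split=> //; rewrite scalerDr.
  move: Vs; rewrite !scalerA (_ : t' / (t + t') * t = u); last by rewrite /u; ring.
  by rewrite (_ : t / (t + t') * t' = u); last by rewrite /u; ring.
rewrite -(ler_pM2l u0) mulrA mulfV ?gt_eqF// mul1r (le_trans sle)//.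
rewrite le_eqVlt; apply/orP; left; apply/eqP; rewrite /u.
by field; rewrite !gt_eqF.
Qed.

Let E_scale d e s : 0 < s -> E d e -> E (s *: d) (s * e).
Proof.
move=> s0 [t [r [t0 Vt ->]]]; exists (t / s), r; split.
- by rewrite divr_gt0.
- by rewrite scalerA mulfVK// gt_eqF.
- by field; rewrite !gt_eqF.
Qed.

Lemma subgrad_sum : exists xi,
  subgrad G (K *m x) xi /\ subgrad F x (c - K^T *m xi).
Proof.
have [Z0 nbZ] := ri0.
have [pi [piid piaff]] := span_projection Z0.
have [e e0 eZ] : exists2 e : R, 0 < e & forall z, `|z| < e ->
    affine_hull (set_sub (dom G) ((fun w => K *m w) @` dom F)) z ->
    set_sub (dom G) ((fun w => K *m w) @` dom F) z.
  move/nbhs_ballP: nbZ => [e/= e0 H]; exists e => // z ze.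
  by apply: H; rewrite -ball_normE/= sub0r normrN.
(* Quotients need not exist outside the span, hence the projection: a small multiple of [pi d] lies
   in the affine hull near 0, so in the difference of domains by [ri0]. *)
have EN0 d : E (pi d) !=set0.
  pose t := e / (`|pi d| + 1).
  have d0 : 0 < `|pi d| + 1 by rewrite ltr_wpDl.
  have t0 : 0 < t by rewrite divr_gt0.
  have /V_dom[r Vr] : set_sub (dom G) ((fun w => K *m w) @` dom F) (t *: pi d).
    apply: eZ; last by rewrite -linearZ; exact: piaff.
    rewrite normrZ gtr0_norm// /t mulrAC ltr_pdivrMr// ltr_pM2l//.
    by rewrite ltrDl.
  by exists (t^-1 * r), t, r.
(* Adding a quotient in the opposite direction gives an element of [E 0], which is nonnegative; this
   is the lower bound. *)
have Einf d : has_inf (E (pi d)).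
  split; first exact: EN0.
  have [e' Ee'] := EN0 (- d); exists (- e') => s Es.
  have [s' + s'le] := E_add Es Ee'.
  by rewrite linearN subrr => /E0; rewrite lerNl; lra.
have pD u v : inf (E (pi (u + v))) <= inf (E (pi u)) + inf (E (pi v)).
  rewrite -lerBlDr; apply: lb_le_inf; first by case: (Einf u).
  move=> s Es; rewrite lerBlDr -lerBlDl.
  apply: lb_le_inf; first by case: (Einf v).
  move=> s' Es'; rewrite lerBlDl; have [s2 Es2 s2le] := E_add Es Es'.
  by apply: le_trans s2le; apply: ge_inf; [case: (Einf (u + v))|rewrite linearD].
have pZ t u : 0 < t -> inf (E (pi (t *: u))) <= t * inf (E (pi u)).
  move=> t0; rewrite -ler_pdivrMl//; apply: lb_le_inf; first by case: (Einf u).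
  move=> s Es; rewrite ler_pdivrMl//; apply: ge_inf; first by case: (Einf (t *: u)).
  by rewrite linearZ; exact: E_scale.
have [xi xiE] := sublinear_support pD pZ.
have xiV z r : V z r -> dot xi z <= r.
  move=> Vz; apply: le_trans (xiE z) _; apply: ge_inf; first by case: (Einf z).
  rewrite piid; last exact: dom_V Vz.
  by exists 1, r; rewrite scale1r invr1 mul1r.
(* The functional xi minorises the value function. Fixing w = x isolates the inequality for G,
   fixing u = K x the one for F. *)
exists xi; split.
  exists b => // u b' Gu.
  suff /xiV : V (u - K *m x) (a + b' - dot c (x - x) - (a + b)).
    by rewrite subrr dot0r; lra.
  by exists x, u, a, b'.
exists a => // w a' Fw.
suff /xiV : V (K *m x - K *m w) (a' + b - dot c (w - x) - (a + b)).
  by rewrite -mulmxBr dot_mulmxr -[x - w]opprB dotNr dotBl; lra.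
by exists w, (K *m x), a', b.
Qed.

End fenchel.
End sum_rule.

(** * Attainment of infima *)

Section ultrafilter_limits.

Lemma fmap_ultra (I T : Type) (U : set_system I) (u : I -> T) :
  UltraFilter U -> UltraFilter (u @ U).
Proof.
move=> UU; apply: Build_UltraFilter => G GP uG.
apply/seteqP; split; last exact: uG.
move=> A GA; have [//|UA] := in_ultra_setVsetC (u @^-1` A) UU.
have : G (~` A) by exact: uG.
by move=> /(filterI GA); rewrite setICr => /filter_not_empty.
Qed.

(** Takes the place of extracting a subsequence: one ultrafilter makes all bounded sequences
    converge at once. *)
Lemma compact_ultra_lim (I : Type) (T : topologicalType) (U : set_system I)
    (u : I -> T) (A : set T) : UltraFilter U -> compact A ->
  (\forall i \near U, A (u i)) -> exists2 x, A x & u @ U --> x.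
Proof.
rewrite compact_ultra => UU /(_ _ (fmap_ultra u UU)) cA uA.
by have [x [Ax ux]] := cA uA; exists x.
Qed.

Lemma eventually_ultra : exists2 U : set_system nat, UltraFilter U & \oo `<=` U.
Proof.
by have [U [UU Uoo]] := ultraFilterLemma (F := \oo) _; exists U.
Qed.

End ultrafilter_limits.

Section attainment.
Variable R : realType.

(* A minimising sequence p_j of f + eps_j |.|^2 either stays bounded or has a
   limit direction e along which f does not increase; then f does not increase
   along -e either, and as p_j - t e cannot have smaller norm than p_j, e is
   orthogonal to itself. *)
Lemma attains_of_symmetric_recession N (f : 'cV[R]_N -> \bar R) :
  Gamma0 f ->
  (forall e : 'cV[R]_N, (forall (w : 'cV[R]_N) t, 0 <= t -> (f (w + t *: e)%R <= f w)%E) ->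
             forall (w : 'cV[R]_N) t, 0 <= t -> (f (w - t *: e)%R <= f w)%E) ->
  exists p a, f p = a%:E /\ forall z, (a%:E <= f z)%E.
Proof.
move=> fG frec; have fN := Gamma0_NNy fG; have [x0 [b0 fx0]] := Gamma0_fin fG.
have lf : lower_semicontinuous f by case: fG.
have fc : econvex f by case: fG.
pose eps j : R := harmonic j.
have eps0 j : 0 < eps j by rewrite /eps /= invr_gt0 ltr0n.
have eps1 j : eps j <= 1 by rewrite /eps /= invf_le1 ?ltr0n// ler1n.
have /choice[w /choice[a wP]] j : exists p a, f p = a%:E /\
    forall z b, f z = b%:E -> a + eps j * dot p p <= b + eps j * dot z z.
  have [p [a [fp pm]]] := sqnorm_perturb_attains 0 fG (eps0 j).
  exists p, a; split=> // z b /pm.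
  by rewrite !sub0r !(dotNl, dotNr) !opprK.
have wf j : f (w j) = (a j)%:E by case: (wP j).
have {wP} wm j z b : f z = b%:E ->
    a j + eps j * dot (w j) (w j) <= b + eps j * dot z z.
  by case: (wP j) => _; exact.
have [U UU Uoo] := eventually_ultra.
have epsU : eps @ U --> (0 : R).
  by apply: cvg_trans (@cvg_harmonic R); exact: cvg_app.
(* The ultrafilter decides: either the w_j are bounded on a set of U, and their limit is a minimiser
   because the penalty eps_j |z|^2 vanishes, or each bound is exceeded on a set of U. *)
have [[r Ur]|Ur] := pselect (exists r : R, U [set j | `|w j| <= r]).
  have [p _ wp] := compact_ultra_lim UU (@compact_ball_cV R N r) Ur.
  have fp z b : f z = b%:E -> (f p <= b%:E)%E.
    move=> fz; apply: (lsc_le_lim (F := U) (b := fun j => b + eps j * dot z z) lf wp).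
      have : b + eps j * dot z z @[j --> U] --> b + 0 * dot z z.
        by apply: cvgD; [exact: cvg_cst|apply: cvgM => //; exact: cvg_cst].
      by rewrite mul0r addr0.
    near=> j; rewrite wf lee_fin (le_trans _ (wm j _ _ fz))// lerDl.
    by rewrite mulr_ge0 ?dot_ge0// ltW.
  have [a0 fa _] := fin_of_le (fN p) (fp _ _ fx0).
  exists p, a0; split=> // z; case fz: (f z) => [b| |]; last by move: (fN z); rewrite fz.
    by rewrite -fa; exact: fp fz.
  by rewrite leey.
have {}Ur r : U [set j | r < `|w j|].
  have [H|] := in_ultra_setVsetC [set j | `|w j| <= r] UU.
    by exfalso; apply: Ur; exists r.
  by apply: filterS => j /= /negP; rewrite -ltNge.
pose e j := `|w j|^-1 *: w j.
have e1 : U [set j | `|e j| = 1].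
  apply: filterS (Ur 0) => j /= wj0.
  by rewrite normrZ normfV normr_id mulVf// gt_eqF.
have [e0 _ ee0] : exists2 x, [set u | `|u| <= 1] x & e @ U --> x.
  apply: compact_ultra_lim; first exact: compact_ball_cV.
  by apply: filterS e1 => j /= ->.
have e01 : `|e0| = 1.
  have h : `|e j| @[j --> U] --> `|e0| by apply: cvg_norm.
  have h1 : `|e j| @[j --> U] --> (1 : R).
    apply: cvg_near_cst; exact: e1.
  exact: (cvg_unique _ h h1).
have invw (t : R) : t / `|w j| @[j --> U] --> (0 : R).
  apply/cvgrPdist_le => d d0; apply: filterS (Ur (`|t| / d)) => j /= tj.
  rewrite sub0r normrN normrM normfV normr_id.
  have wj0 : 0 < `|w j| by apply: le_lt_trans tj; rewrite divr_ge0// ltW.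
  by rewrite ler_pdivrMr// mulrC -ler_pdivrMr// ltW.
have ale j : a j <= b0 + dot x0 x0.
  have := wm j _ _ fx0; have := dot_ge0 (w j); have := dot_ge0 x0.
  have := eps0 j; have := eps1 j; nra.
(* The point at distance about t from z on the segment towards w_j tends to z + t e0. As the values
   a_j are bounded above and the weight t / |w_j| vanishes, convexity bounds f there by a quantity
   tending to f z. *)
have rec z t : 0 <= t -> (f (z + t *: e0)%R <= f z)%E.
  rewrite le_eqVlt => /orP[/eqP <-|t0]; first by rewrite scale0r addr0.
  case fz: (f z) => [b| |]; last by move: (fN z); rewrite fz.
    pose s j := t / `|w j|.
    have s0 : s @ U --> (0 : R) := invw t.
    have s1 : (1 - s j) @[j --> U] --> (1 : R).
      by rewrite -[X in _ --> X]subr0; apply: cvgB => //; exact: cvg_cst.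
    apply: (lsc_le_lim (F := U) (u := fun j => s j *: w j + (1 - s j) *: z)
      (b := fun j => s j * (b0 + dot x0 x0) + (1 - s j) * b) lf).
    - have : s j *: w j + (1 - s j) *: z @[j --> U] --> t *: e0 + 1 *: z.
        apply: cvgD; last by apply: cvgZ => //; exact: cvg_cst.
        rewrite (_ : (fun j => s j *: w j) = (fun j => t *: e j)).
          by apply: cvgZ => //; exact: cvg_cst.
        by apply/funext => j; rewrite /s/e scalerA.
      by rewrite scale1r addrC.
    - have : s j * (b0 + dot x0 x0) + (1 - s j) * b @[j --> U]
          --> 0 * (b0 + dot x0 x0) + 1 * b.
        by apply: cvgD; apply: cvgM => //; exact: cvg_cst.
      by rewrite mul0r add0r mul1r.
    - apply: filterS (Ur t) => j /= tw.
      have wj0 : 0 < `|w j| by apply: lt_trans tw.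
      have s01 : 0 < s j < 1 by rewrite divr_gt0//= ltr_pdivrMr// mul1r.
      have [c -> cle] := econvex_fin fN fc s01 (wf j) fz.
      rewrite lee_fin (le_trans cle)// lerD2r ler_wpM2l//.
      by case/andP: s01 => /ltW.
  by rewrite leey.
have we j : dot (w j) e0 <= 0.
  suff : 0 <= - (2 * dot (w j) e0) by lra.
  apply: (@ge0_of_quadratic _ _ (dot e0 e0)) => t /andP[t0 _].
  have := frec _ rec (w j) _ (ltW t0); rewrite wf => /(fin_of_le (fN _))[b fb ble].
  have := wm j _ _ fb; have ej := eps0 j; rewrite !(dotBl, dotBr, dotZl, dotZr) (dotC e0).
  move=> h; suff : 0 <= eps j * (t * - (2 * dot (w j) e0) + t ^+ 2 * dot e0 e0).
    by rewrite pmulr_rge0.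
  rewrite expr2; nra.
have : dot e0 e0 <= 0.
  have ed : dot (e j) e0 @[j --> U] --> dot e0 e0.
    by apply: dot_cvg => //; exact: cvg_cst.
  apply: (cvgr_to_le ed); near=> j; by rewrite /e dotZl mulr_ge0_le0 ?invr_ge0.
move=> ee; have : e0 = 0 by apply/eqP; rewrite -dot_eq0 eq_le ee dot_ge0.
by move=> e00; move: e01; rewrite e00 normr0 => /esym/eqP; rewrite oner_eq0.
Unshelve. all: by end_near. Qed.

End attainment.

(** * The functions psi and their envelopes *)

Section partial_minimum.
Variables (R : realType) (m l : nat) (phi : 'cV[R]_(m + l) -> \bar R).
Hypotheses (phiG : Gamma0 phi) (A1 : assumption_A1 phi).

Let phiN := Gamma0_NNy phiG.

Lemma psi_attained u : exists s a, phi (col_mx u s) = a%:E /\ psi phi u = a%:E.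
Proof.
have [[hN [s0 s0fin]] hco] := (A1.2 u).
have [a0 fs0 _] : exists2 a0, phi (col_mx u s0) = a0%:E & True.
  move: s0fin (phiN (col_mx u s0)); rewrite /dom/=.
  by case: (phi _) => // a _ _; exists a.
have [r hr] := hco a0.
have cu : continuous (fun s : 'cV[R]_l => col_mx u s : 'cV[R]_(m + l)).
  have -> : (fun s : 'cV[R]_l => col_mx u s) =
      (fun s => col_mx u 0 + col_mx 0 1%:M *m s).
    by apply/funext => s; rewrite mul_col_mx mul0mx mul1mx add_col_mx addr0 add0r.
  by move=> s; apply: (@cvgD _ _ _ (nbhs s) _ (fun=> _)); [exact: cvg_cst|exact: mulmx_continuous].
have [|//||s smin] := @lsc_attains _ _ (phi \o col_mx u) s0 r.
- by apply: lsc_comp cu; case: phiG.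
- by move=> s rs; rewrite /= fs0; apply: hr; apply: lt_le_trans rs (normr_le_enorm _).
have [|a fs _] := @fin_of_le _ (phi (col_mx u s)) a0 (phiN _).
  by rewrite -fs0; exact: smin.
exists s, a; split=> //; apply/eqP; rewrite eq_le; apply/andP; split.
  by apply: ereal_inf_lbound; exists s.
by apply: le_ereal_inf_tmp => _ [s' _ <-]; rewrite -fs; exact: smin.
Qed.

Definition psir u : R := fine (psi phi u).

Lemma psiE u : psi phi u = (psir u)%:E.
Proof. by rewrite /psir; have [s [a [_ ->]]] := psi_attained u. Qed.

Lemma psir_attained u : exists s, phi (col_mx u s) = (psir u)%:E.
Proof. by have [s [a [fs pa]]] := psi_attained u; exists s; rewrite fs -pa psiE. Qed.

Lemma psir_le u s b : phi (col_mx u s) = b%:E -> psir u <= b.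
Proof.
by move=> fs; rewrite -lee_fin -psiE -fs; apply: ereal_inf_lbound; exists s.
Qed.

Lemma psir_convex u u' t : 0 < t < 1 ->
  psir (t *: u + (1 - t) *: u') <= t * psir u + (1 - t) * psir u'.
Proof.
move=> t01; have [s fs] := psir_attained u; have [s' fs'] := psir_attained u'.
have [_ _ fc] := phiG.
have [c + cle] := econvex_fin phiN fc t01 fs fs'.
by rewrite !scale_col_mx add_col_mx => /psir_le /le_trans; apply.
Qed.

(** Because the second block of the subgradient is zero, the variable s' can be chosen freely, in
    particular as the minimiser for u'. *)
Lemma subgrad_psir u s r : subgrad phi (col_mx u s) (col_mx r 0) ->
  phi (col_mx u s) = (psir u)%:E /\
  forall u', psir u + dot r (u' - u) <= psir u'.
Proof.
move=> [a fa sub].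
have le u' : a + dot r (u' - u) <= psir u'.
  have [s' fs'] := psir_attained u'; have := sub _ _ fs'.
  by rewrite opp_col_mx add_col_mx dot_col_mx dot0l addr0.
have aE : a = psir u.
  apply/eqP; rewrite eq_le (psir_le fa) andbT.
  by have := le u; rewrite subrr dot0r addr0.
by rewrite fa aE; split=> // u'; rewrite -aE.
Qed.

Section envelope.
Variables (q : nat) (B : 'M[R]_(q, m)).

Definition env (u : 'cV[R]_m) : \bar R :=
  ereal_inf (range (fun v : 'cV[R]_m =>
     psi phi v + (2^-1 * enorm (B *m (u - v)) ^+ 2)%R%:E)%E).

Definition envr u : R := fine (env u).

Lemma env_le u v :
  (env u <= (psir v + 2^-1 * dot (B *m (u - v)) (B *m (u - v)))%:E)%E.
Proof. by apply: ereal_inf_lbound; exists v => //; rewrite psiE enormK. Qed.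

Hypothesis phi_sym :
  (forall (u : 'cV[R]_m) (s : 'cV[R]_l),
         phi (col_mx (- u) s) = phi (col_mx u s)) \/
  (forall (u : 'cV[R]_m) (s : 'cV[R]_l),
         phi (col_mx (- u) s) = phi (col_mx u (- s))).

(** If phi is even the claim is immediate. Otherwise the reflection S of the first block preserves
    phi, so e + S e = (0, 2 de) is again a direction along which phi does not increase; coercivity
    of phi(0, .) forces de = 0, and then S e = - e. *)
Lemma recession_symmetric (e : 'cV[R]_(m + l)) :
  (forall w t, 0 <= t -> (phi (w + t *: e)%R <= phi w)%E) ->
  forall w t, 0 <= t -> (phi (w - t *: e)%R <= phi w)%E.
Proof.
move=> rec.
case: phi_sym => sym w t t0; last first.
  have sN z : phi (- z) = phi z.
    by rewrite -[z]vsubmxK opp_col_mx sym opprK.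
  by rewrite -sN opprB addrC -[leRHS]sN; exact: rec.
pose S (z : 'cV[R]_(m + l)) := col_mx (- usubmx z) (dsubmx z).
have SE a b : S (col_mx a b) = col_mx (- a) b by rewrite /S col_mxKu col_mxKd.
have phiS z : phi (S z) = phi z by rewrite /S sym vsubmxK.
have recS z t' : 0 <= t' -> (phi (z + t' *: S e)%R <= phi z)%E.
  move=> t'0; rewrite -phiS -[leRHS]phiS.
  have -> : S (z + t' *: S e) = S z + t' *: e.
    rewrite -[e]vsubmxK -[z]vsubmxK !SE !scale_col_mx !add_col_mx !SE.
    by rewrite opprD scalerN opprK.
  exact: rec.
suff e0 : dsubmx e = 0.
  rewrite -scalerN; suff <- : S e = - e by exact: recS.
  by rewrite /S -[e in RHS]vsubmxK opp_col_mx e0 oppr0.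
pose de := dsubmx e; pose u0 : 'cV[R]_m := 0.
have [_ hco] := A1.2 u0; have [s0 fs0] := psir_attained u0.
have [r hr] := hco (psir u0).
have bnd t' : 0 <= t' -> enorm (s0 + t' *: (2 *: de)) <= r.
  move=> t'0; rewrite leNgt; apply/negP => /hr; apply/negP; rewrite -leNgt -fs0.
  have -> : col_mx u0 (s0 + t' *: (2 *: de)) = col_mx u0 s0 + t' *: e + t' *: S e.
    rewrite -addrA -scalerDr -{1}[e]vsubmxK /S add_col_mx addrN -/de.
    by rewrite scale_col_mx add_col_mx scaler0 addr0 scaler_nat mulr2n.
  by apply: (le_trans (recS _ _ t'0)); exact: rec.
have r0 : 0 <= r by apply: le_trans (bnd 0 (lexx _)); exact: enorm_ge0.
suff : dot (2 *: de) (2 *: de) <= 0.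
  move=> de0; have /eqP : 2 *: de = 0.
    by apply/eqP; rewrite -dot_eq0 eq_le de0 dot_ge0.
  by rewrite scaler_eq0 pnatr_eq0/= => /eqP.
apply: (@le0_of_quadratic _ _ (r ^+ 2) (- (2 * dot s0 (2 *: de)))) => t' t'0.
have : enorm (s0 + t' *: (2 *: de)) ^+ 2 <= r ^+ 2.
  by rewrite ler_pXn2r ?nnegrE ?enorm_ge0// bnd.
rewrite enormK; move: (2 *: de) => d; rewrite !(dotDl, dotDr, dotZl, dotZr) (dotC d).
by have := dot_ge0 s0; rewrite expr2; lra.
Qed.

(** The sum phi + 1/2 |B (u - .)|^2 is minimised jointly in both blocks, and Fermat's rule at the
    minimiser gives a subgradient whose second block vanishes since the quadratic ignores that
    block. *)
Lemma envelope_attained u : exists v t,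
  subgrad phi (col_mx v t) (col_mx (B^T *m (B *m (u - v))) 0).
Proof.
pose K : 'M[R]_(q, m + l) := row_mx B 0; pose k := B *m u.
have KE (w : 'cV[R]_(m + l)) : K *m w = B *m usubmx w.
  by rewrite -{1}[w]vsubmxK mul_row_col mul0mx addr0.
pose h (w : 'cV[R]_(m + l)) : R := 1 / 2 * dot (k - K *m w) (k - K *m w).
pose F w := (phi w + (h w)%:E)%E.
have h0 w : 0 <= h w by rewrite mulr_ge0 ?dot_ge0// divr_ge0.
have FN w : F w != -oo%E by rewrite /F; move: (phiN w); case: (phi w).
have [[_ [w0 w0fin]] lphi cphi] := phiG.
have FG : Gamma0 F.
  split.
  - split=> //; exists w0; move: w0fin; rewrite /dom/= /F.
    by case: (phi w0) => // a _; rewrite ltry.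
  - apply: lsc_addr_continuous => // w.
    apply: (@cvgM R _ (nbhs w) _ (fun=> 1 / 2)); first exact: cvg_cst.
    by apply: dot_cvg; apply: cvgB; [exact: cvg_cst|exact: mulmx_continuous|
                                   exact: cvg_cst|exact: mulmx_continuous].
  - move=> w w' t t01; rewrite /F.
    case fw : (phi w) => [a| |]; last by move: (phiN w); rewrite fw.
      case fw' : (phi w') => [b| |]; last by move: (phiN w'); rewrite fw'.
        have [c -> cle] := econvex_fin phiN cphi t01 fw fw'.
        rewrite -!(EFinD, EFinM) lee_fin.
        have : h (t *: w + (1 - t) *: w') <= t * h w + (1 - t) * h w'.
          rewrite /h mulmxDr -!scalemxAr.
          have -> : k - (t *: (K *m w) + (1 - t) *: (K *m w')) =
              t *: (k - K *m w) + (1 - t) *: (k - K *m w').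
            by apply/colP => i; rewrite !mxE; ring.
          move: (k - _) (k - _) => x z.
          have : 0 <= t * (1 - t) * dot (x - z) (x - z).
            by rewrite mulr_ge0 ?dot_ge0// mulr_ge0//; case/andP: t01; lra.
          rewrite !(dotDl, dotDr, dotNl, dotNr, dotZl, dotZr) (dotC z x); lra.
        by move: cle; lra.
      rewrite (_ : (+oo + _)%E = +oo%E)// gt0_muley ?lte_fin; last first.
        by rewrite subr_gt0; case/andP: t01.
      by rewrite addey ?leey// -EFinM.
    rewrite (_ : (+oo + _)%E = +oo%E)// gt0_muley ?lte_fin; last by case/andP: t01.
    rewrite addye ?leey//.
    move: (FN w'); rewrite /F; case: (_ + _)%E => [b| |]// _.
    by rewrite gt0_muley// lte_fin subr_gt0; case/andP: t01.
have [|w [a [Fw wmin]]] := @attains_of_symmetric_recession R _ F FG.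
  move=> e recF.
  have [b0 fw0 _] : exists2 b0, phi w0 = b0%:E & True.
    by move: w0fin (phiN w0); rewrite /dom/=; case: (phi w0) => // b0 _ _; exists b0.
  have [c cle] := A1.1.
  (* As phi >= c, the quadratic h stays bounded along the ray from w0, so its leading coefficient
     vanishes. Then h is constant along e, and e is a recession direction of phi itself. *)
  have Ke0 : K *m e = 0.
    apply/eqP; rewrite -dot_eq0 eq_le dot_ge0 andbT.
    apply: (@le0_of_quadratic _ _ (2 * (b0 + h w0 - c)) (2 * dot (k - K *m w0) (K *m e))) => t t0.
    have := recF w0 _ t0; rewrite /F fw0 -EFinD => le1.
    have : ((c + h (w0 + t *: e))%:E <= (b0 + h w0)%:E)%E.
      by apply: le_trans le1; rewrite EFinD leeD2r.
    rewrite lee_fin {1}/h mulmxDr -scalemxAr opprD addrA.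
    move: (k - K *m w0) (K *m e) => x z.
    have := dot_ge0 x.
    by rewrite !(dotBl, dotBr, dotZl, dotZr) (dotC z) expr2; lra.
  have hK w t : h (w + t *: e) = h w by rewrite /h mulmxDr -scalemxAr Ke0 scaler0 addr0.
  have hKN w t : h (w - t *: e) = h w by rewrite -scaleNr hK.
  have rec w t : 0 <= t -> (phi (w + t *: e)%R <= phi w)%E.
    by move=> t0; have := recF w _ t0; rewrite /F hK leeD2rE.
  by move=> w t t0; rewrite /F hKN leeD2rE//; exact: recession_symmetric.
have [a' fw _] : exists2 a', phi w = a'%:E & True.
  by move: Fw (phiN w); rewrite /F; case: (phi w) => // a' _ _; exists a'.
have := @subgrad_of_min _ _ _ phi K k 1 w a' phiN cphi fw.
have -> : 1 *: (K^T *m (k - K *m w)) = col_mx (B^T *m (B *m (u - usubmx w))) 0.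
  by rewrite scale1r KE /k -mulmxBr tr_row_mx trmx0 mul_col_mx mul0mx.
move=> H; exists (usubmx w), (dsubmx w); rewrite vsubmxK; apply: H => z b fz.
have := wmin z; rewrite -Fw /F fw fz -!EFinD lee_fin.
by rewrite /h.
Qed.

(** After the subgradient inequality at v, the gap at each competitor w is 1/2 |B (u' - u) - B (w -
    v)|^2. Besides the minorant this shows that the envelope is finite. *)
Lemma env_affine_minorant u v t :
  subgrad phi (col_mx v t) (col_mx (B^T *m (B *m (u - v))) 0) ->
  forall u', ((psir v + 2^-1 * dot (B *m (u - v)) (B *m (u - v)) +
              dot (B *m (u - v)) (B *m (u' - u)))%:E <= env u')%E.
Proof.
move=> /subgrad_psir[_ sub] u'; apply: le_ereal_inf_tmp => _ [w _ <-].
rewrite psiE enormK -EFinD lee_fin; have := sub w.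
rewrite dot_mulmxl trmxK.
rewrite (_ : B *m (u' - w) = B *m (u - v) + B *m (u' - u) - B *m (w - v)); last first.
  by rewrite -!(mulmxDr, mulmxBr); congr (_ *m _); apply/colP => i; rewrite !mxE; ring.
move: (B *m (u - v)) (B *m (u' - u)) (B *m (w - v)) => a b c.
have := dot_ge0 (b - c).
by rewrite !(dotDl, dotDr, dotNl, dotNr, dotZl, dotZr) (dotC b a) (dotC c a) (dotC c b); lra.
Qed.

Lemma envE u : env u = (envr u)%:E.
Proof.
have [v [t sub]] := envelope_attained u.
have := env_affine_minorant sub u; have := env_le u v; rewrite /envr.
by case: (env u).
Qed.

Lemma envr_le u v : envr u <= psir v + 2^-1 * dot (B *m (u - v)) (B *m (u - v)).
Proof. by rewrite -lee_fin -envE; exact: env_le. Qed.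

Lemma envr_affine_minorant u v t :
  subgrad phi (col_mx v t) (col_mx (B^T *m (B *m (u - v))) 0) ->
  forall u', psir v + 2^-1 * dot (B *m (u - v)) (B *m (u - v)) +
              dot (B *m (u - v)) (B *m (u' - u)) <= envr u'.
Proof. by move=> /env_affine_minorant H u'; rewrite -lee_fin -envE. Qed.

Lemma envr_attained u v t :
  subgrad phi (col_mx v t) (col_mx (B^T *m (B *m (u - v))) 0) ->
  envr u = psir v + 2^-1 * dot (B *m (u - v)) (B *m (u - v)).
Proof.
move=> /envr_affine_minorant/(_ u); rewrite subrr mulmx0 dot0r addr0 => H.
by apply/eqP; rewrite eq_le H envr_le.
Qed.

End envelope.

End partial_minimum.

(** * Fixed points of T and minimisers of J *)

Section operator.
Variables (R : realType) (d n m l q p : nat).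
Variables (A : 'M[R]_(d, n)) (y : 'cV[R]_d) (L : 'M[R]_(m, n)) (B : 'M[R]_(q, m)).
Variables (M : 'M[R]_(p, l)) (lam : R) (C : set 'cV[R]_n).
Variables (f : 'cV[R]_(m + l) -> \bar R) (g : 'cV[R]_p -> \bar R).
Variables (gam1 gam2 gam3 gam4 : R).
Hypotheses (C_neq0 : C !=set0) (C_closed : closed C) (C_convex : convex_set C).
Hypotheses (fG : Gamma0 f) (gG : Gamma0 g).
Hypotheses (gam1_gt0 : 0 < gam1) (gam3_gt0 : 0 < gam3) (gam4_gt0 : 0 < gam4).

Definition forward (x : 'cV[R]_n) (v r : 'cV[R]_m) : 'cV[R]_n :=
  Qmx A L B lam *m x - A^T *m y + lam *: (L^T *m B^T *m B *m v)
    + lam *: (L^T *m r).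

Lemma col_mx_eq (a : 'cV[R]_(m + l)) (b : 'cV[R]_m) (c : 'cV[R]_l) :
  a = col_mx b c <-> usubmx a = b /\ dsubmx a = c.
Proof.
by split=> [->|[<- <-]]; rewrite ?col_mxKu ?col_mxKd ?vsubmxK.
Qed.

(* One step z |-> z' of T, as a system of inclusions that is affine in (z, z') *)
Lemma TopP x s v t r eta xi zeta x' s' v' t' r' eta' xi' zeta' :
  Top A y L B M lam C f g gam1 gam2 gam3 gam4
    (x, s, v, t, r, eta, xi, zeta) = (x', s', v', t', r', eta', xi', zeta') <->
  [/\ C x' /\ (forall z, C z ->
        dot (gam1^-1 *: (x - x') - forward x v r) (z - x') <= 0),
      s' = s - gam2 *: (eta + M^T *m xi) &
      [/\ subgrad f (col_mx v' t')
            (col_mx (gam3^-1 *: (v - v') + B^T *m (B *m (L *m (2 *: x' - x) - v)))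
                    (gam3^-1 *: (t - t') - M^T *m zeta)),
          subgrad f (col_mx (r - r' + L *m (2 *: x' - x)) (eta - eta' + (2 *: s' - s)))
            (col_mx r' eta'),
          subgrad g (xi - xi' + M *m (2 *: s' - s)) xi' &
          subgrad g (gam4^-1 *: (zeta - zeta') + M *m (2 *: t' - t)) zeta']].
Proof.
have gN (c : R) : 0 < c -> c != 0 by move=> c0; rewrite gt_eqF.
have projE w : Defs.proj C (x - gam1 *: forward x v r) = w <->
    C w /\ forall z, C z ->
        dot (gam1^-1 *: (x - w) - forward x v r) (z - w) <= 0.
  split=> [/(projP C_neq0 C_closed C_convex)|] [Cw wP].
    split=> // z /wP; rewrite -(@pmulr_rle0 _ gam1^-1) ?invr_gt0// -dotZl.
    rewrite addrAC [_ *: (_ - gam1 *: _)]scalerBr [_ *: (gam1 *: _)]scalerA.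
    by rewrite mulVf ?gN// scale1r.
  apply/(projP C_neq0 C_closed C_convex); split=> // z /wP.
  rewrite -(@pmulr_rle0 _ gam1)// -dotZl scalerBr scalerA mulfV ?gN// scale1r.
  by rewrite addrAC.
have fproxE w a b : prox (escale gam3 f)
      (col_mx (v + gam3 *: (B^T *m B *m (L *m w - v))) (t - gam3 *: (M^T *m zeta)))
      = col_mx a b <->
    subgrad f (col_mx a b)
      (col_mx (gam3^-1 *: (v - a) + B^T *m (B *m (L *m w - v)))
              (gam3^-1 *: (t - b) - M^T *m zeta)).
  rewrite prox_escaleP// opp_col_mx add_col_mx scale_col_mx mulmxA.
  rewrite addrAC [gam3^-1 *: (v - a + _)]scalerDr.
  rewrite addrAC [gam3^-1 *: (t - b + _)]scalerDr scalerN.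
  by rewrite !scalerA mulVf ?gN// !scale1r.
have fconjE w w' a b :
    prox (conjugate f) (col_mx (r + L *m w) (eta + w')) = col_mx a b <->
    subgrad f (col_mx (r - a + L *m w) (eta - b + w')) (col_mx a b).
  by rewrite prox_conjugateP// opp_col_mx add_col_mx addrAC [eta + w' - b]addrAC.
have gconjE w a : prox (conjugate g) (xi + M *m w) = a <->
    subgrad g (xi - a + M *m w) a.
  by rewrite prox_conjugateP// addrAC.
have gprox w a :
    prox (escale gam4 (conjugate g)) (zeta + gam4 *: (M *m w)) = a <->
    subgrad g (gam4^-1 *: (zeta - a) + M *m w) a.
  rewrite prox_escale_conjugateP// addrAC scalerDr scalerA mulVf ?gN//.
  by rewrite scale1r.
rewrite /Top; split.
  case=> E1; rewrite E1 => E2; rewrite E2 => E3 E4; rewrite E4 => E5 E6 E7 E8.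
  split; [exact/projE|by []|split].
  - by apply/fproxE/col_mx_eq.
  - by rewrite -addrA in E5 E6 *; apply/fconjE/col_mx_eq.
  - exact/gconjE.
  - exact/gprox.
move=> [/projE E1 E2 [/fproxE E3 /fconjE E4 /gconjE E5 /gprox E6]].
rewrite /forward in E1; rewrite E1 -E2 E3 col_mxKu col_mxKd E6.
by rewrite -[eta + _ - s]addrA E4 col_mxKu col_mxKd E5.
Qed.

End operator.

(** * Optimality conditions for J over C *)

Section optimality.
Variables (R : realType) (d n m l q p : nat).
Variables (A : 'M[R]_(d, n)) (y : 'cV[R]_d) (L : 'M[R]_(m, n)) (B : 'M[R]_(q, m)).
Variables (M : 'M[R]_(p, l)) (lam : R) (C : set 'cV[R]_n).
Variables (phi f : 'cV[R]_(m + l) -> \bar R) (g : 'cV[R]_p -> \bar R).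
Hypotheses (lam_gt0 : 0 < lam) (C_convex : convex_set C).
Hypotheses (phiG : Gamma0 phi) (fG : Gamma0 f) (gG : Gamma0 g).
Hypotheses (hA1 : assumption_A1 phi) (hA2 : assumption_A2 phi f g M).
Hypotheses (hA3 : assumption_A3 phi f g L M) (Q_psd : psdmx (Qmx A L B lam)).

Let phiN := Gamma0_NNy phiG.

Lemma phi_fin w b : phi w = b%:E ->
  exists a c, [/\ f w = a%:E, g (M *m dsubmx w) = c%:E & b = a + c].
Proof.
rewrite -{1}[w]vsubmxK hA2 vsubmxK.
move: (Gamma0_NNy fG w) (Gamma0_NNy gG (M *m dsubmx w)).
case: (f w) => [a| |]//; case: (g _) => [c| |]// _ _ [<-].
by exists a, c.
Qed.

Lemma phi_finE w a c : f w = a%:E -> g (M *m dsubmx w) = c%:E ->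
  phi w = (a + c)%:E.
Proof. by move=> fw gw; rewrite -[w]vsubmxK hA2 vsubmxK fw gw. Qed.

(** One direction is the sum rule with K = [Mbar], whose adjoint puts M^T xi in the second block,
    where the total has to be 0; the other adds two subgradient inequalities. *)
Lemma subgrad_phiP w r : subgrad phi w (col_mx r 0) <->
  exists xi, subgrad g (M *m dsubmx w) xi /\
             subgrad f w (col_mx r (- (M^T *m xi))).
Proof.
have MbE z : Mbar m M *m z = M *m dsubmx z.
  by rewrite -{1}[z]vsubmxK mul_row_col mul0mx add0r.
have [_ _ riA3] := hA3; split.
  move=> [b /phi_fin[a [c [fw gw ->]]] sub].
  have [_ _ fc] := fG; have [_ _ gc] := gG.
  have [||xi [gxi fxi]] := @subgrad_sum _ _ _ f g (Mbar m M) w (col_mx r 0) a c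
      (Gamma0_NNy fG) (Gamma0_NNy gG) fc gc fw _ _ riA3; rewrite ?MbE//.
    by move=> z a' c' fz; rewrite MbE => gz; apply: sub; exact: phi_finE.
  exists xi; split; first by rewrite MbE in gxi.
  move: fxi; rewrite tr_row_mx trmx0 mul_col_mx mul0mx opp_col_mx add_col_mx.
  by rewrite oppr0 addr0 add0r.
move=> [xi [[c gw gsub] [a fw fsub]]]; exists (a + c); first exact: phi_finE.
move=> z b /phi_fin[a' [c' [fz gz ->]]].
have := fsub _ _ fz; have := gsub _ _ gz.
rewrite -mulmxBr dot_mulmxr !dot_vsub !col_mxKu !col_mxKd dotNl dot0l addr0.
by rewrite [dsubmx (z - w)]linearB/= !dotBr; lra.
Qed.

Let psi := psir phi.
Let env_ := envr phi B.

Let phi_sym := let: And3 h _ _ := hA3 in h.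

Lemma JE x : J A y L B lam phi x =
  (2^-1 * dot (y - A *m x) (y - A *m x) + lam * (psi (L *m x) - env_ (L *m x)))%:E.
Proof.
rewrite /J enormK /Psi (psiE phiG hA1) -/(env phi B (L *m x)).
by rewrite (envE phiG hA1 _ phi_sym).
Qed.

(** The optimality system before phi is split into f and g: v attains the envelope at L x, r is a
    subgradient of psi at L x, and t, s are the inner minimisers at v and L x. *)
Definition stationary x v t s r :=
  [/\ C x /\ (forall z, C z -> 0 <= dot (forward A y L B lam x v r) (z - x)),
      subgrad phi (col_mx v t) (col_mx (B^T *m (B *m (L *m x - v))) 0) &
      subgrad phi (col_mx (L *m x) s) (col_mx r 0)].

Lemma dot_forward x v r (e : 'cV[R]_n) :
  dot (forward A y L B lam x v r) e =
  - dot (y - A *m x) (A *m e) - lam * dot (B *m (L *m x - v)) (B *m (L *m e))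
  + lam * dot r (L *m e).
Proof.
rewrite /forward /Qmx mulmxBl -scalemxAl -!mulmxA.
rewrite !mulmxBr !(dotDl, dotNl, dotZl) !dot_mulmxl !trmxK; ring.
Qed.

Lemma Q_dot (e : 'cV[R]_n) :
  0 <= dot (A *m e) (A *m e) - lam * dot (B *m (L *m e)) (B *m (L *m e)).
Proof.
have [_ /(_ e)] := Q_psd; rewrite /Qmx mulmxBl -scalemxAl -!mulmxA dotBr dotZr.
by rewrite (dot_mulmxr A^T) (dot_mulmxr L^T) (dot_mulmxr B^T) !trmxK.
Qed.

(** Bounding the envelope at L z through the fixed competitor v gives J z - J x >= <forward, e> +
    1/2 <e, Q e> with e = z - x, and both terms are nonnegative. *)
Lemma stationary_solution x v t s r : stationary x v t s r ->
  argmin C (J A y L B lam phi) x.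
Proof.
move=> [[Cx xP] subv subx]; split=> [//|z Cz]; rewrite !JE lee_fin.
rewrite /env_ (envr_attained phiG hA1 phi_sym subv).
have := envr_le phiG hA1 B phi_sym (L *m z) v.
have [_ /(_ (L *m z))] := subgrad_psir phiG hA1 subx.
have := xP _ Cz; rewrite dot_forward -!mulmxBr.
have := Q_dot (z - x).
rewrite (_ : y - A *m z = (y - A *m x) - A *m (z - x)); last first.
  by rewrite mulmxBr opprB addrA subrK.
rewrite (_ : B *m (L *m z - v) = B *m (L *m x - v) + B *m (L *m (z - x))); last first.
  by rewrite -mulmxDr [L *m (_ - _)]mulmxBr; congr (_ *m _); apply/colP => i; rewrite !mxE; ring.
rewrite -/psi -/env_.
move: (A *m (z - x)) (y - A *m x) (B *m (L *m (z - x))) (B *m (L *m x - v)).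
move=> a b a' b'; move: (dot r _) (psi _) (psi _) (psi _) (env_ _) => D pz px pv ez.
rewrite !(dotDl, dotDr, dotNl, dotNr) (dotC a b) (dotC a' b') => h1 h2.
move=> /(ler_wpM2l (ltW lam_gt0)) h3 /(ler_wpM2l (ltW lam_gt0)) h4.
move: (dot a a) (dot b a) (dot b b) (dot a' a') (dot b' a') (dot b' b') h1 h2 h3 h4.
by move=> aa ba bb aa' ba' bb' h1 h2 h3 h4; lra.
Qed.

Lemma solution_stationary x : argmin C (J A y L B lam phi) x ->
  exists v t s r, stationary x v t s r.
Proof.
move=> [Cx xmin].
have [v [t subv]] := envelope_attained phiG hA1 B phi_sym (L *m x).
pose c := forward A y L B lam x v 0.
have cE e : dot c e = - dot (y - A *m x) (A *m e) -
    lam * dot (B *m (L *m x - v)) (B *m (L *m e)).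
  by rewrite /c dot_forward dot0l mulr0 addr0.
have cP z : C z -> 0 <= dot c (z - x) + lam * (psi (L *m z) - psi (L *m x)).
  move=> Cz; apply: (@ge0_of_quadratic _ _
    (2^-1 * dot (A *m (z - x)) (A *m (z - x)))) => h h01.
  have := xmin _ (convex_setP C_convex h01 Cz Cx); rewrite !JE lee_fin.
  have := psir_convex phiG hA1 (L *m z) (L *m x) h01; rewrite -/psi.
  have := envr_affine_minorant phiG hA1 phi_sym subv
    (L *m (h *: z + (1 - h) *: x)); rewrite -/env_.
  rewrite -(envr_attained phiG hA1 phi_sym subv) -/env_ cE.
  rewrite !scalemxAr -mulmxDr.
  have zE : h *: z + (1 - h) *: x = x + h *: (z - x).
    by apply/colP => i; rewrite !mxE; ring.
  rewrite !zE (_ : L *m (x + h *: (z - x)) - L *m x = h *: (L *m (z - x))); last first.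
    by rewrite mulmxDr addrAC subrr add0r scalemxAr.
  rewrite (_ : y - A *m (x + _) = (y - A *m x) - h *: (A *m (z - x))); last first.
    by rewrite mulmxDr opprD addrA scalemxAr.
  rewrite -[B *m (h *: _)]scalemxAr dotZr.
  move: (A *m (z - x)) (y - A *m x) (dot (B *m (L *m x - v)) _) => a b D.
  move: (psi _) (psi _) (psi _) (env_ _) (env_ _) => ph pz px ex eh.
  rewrite !(dotBl, dotBr, dotZl, dotZr) (dotC a b) expr2 => h1 h2 h3.
  have {}h1 := ler_wpM2l (ltW lam_gt0) h1.
  have {}h2 := ler_wpM2l (ltW lam_gt0) h2.
  lra.
have [s phis] := psir_attained phiG hA1 (L *m x).
(* The sum rule is applied to the indicator of C x R^l and to phi composed with [Lbar], so that s is
   a variable alongside x; c is divided by lam because phi enters unscaled. *)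
pose F (w : 'cV[R]_(n + l)) := indicator C (usubmx w).
have FN w : F w != -oo%E by rewrite /F /indicator; case: ifP.
have F_fin w b : F w = b%:E -> C (usubmx w) /\ b = 0 by exact: indicator_fin.
have Fc : econvex F.
  move=> w w' h h01; have /= [h0 h1] := andP h01.
  have h1' : 0 < 1 - h by rewrite subr_gt0.
  have Fy z : ~ C (usubmx z) -> F z = +oo%E.
    by move=> nC; rewrite /F /indicator ifF//; apply/negP => /set_mem.
  have F0 z : C (usubmx z) -> F z = 0%E by exact: indicatorE.
  have [Cw|/Fy ->] := pselect (C (usubmx w)); last first.
    rewrite gt0_muley ?lte_fin// addye ?leey//.
    by have [/F0 ->|/Fy ->] := pselect (C (usubmx w')); rewrite ?mule0// gt0_muley ?lte_fin.
  rewrite (F0 _ Cw) mule0 add0e.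
  have [Cw'|/Fy ->] := pselect (C (usubmx w')); last by rewrite gt0_muley ?lte_fin// leey.
  rewrite (F0 _ Cw') mule0 F0// linearD !linearZ/=; exact: convex_setP.
have LE w : Lbar l L *m w = col_mx (L *m usubmx w) (dsubmx w).
  rewrite -{1}[w]vsubmxK mul_block_col !mul0mx add0r addr0.
  by rewrite mul1mx.
pose w0 : 'cV[R]_(n + l) := col_mx x s.
have Fw0 : F w0 = 0%:E by rewrite /F col_mxKu indicatorE.
have phiw0 : phi (Lbar l L *m w0) = (psi (L *m x))%:E.
  by rewrite LE col_mxKu col_mxKd.
have full z : set_sub (dom phi) ((fun w => Lbar l L *m w) @` dom F) z.
  have [s' phis'] := psir_attained phiG hA1 (usubmx z + L *m x).
  exists (col_mx (usubmx z + L *m x) s'); first by rewrite /dom/= phis' ltry.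
  exists (col_mx (L *m x) (s' - dsubmx z)).
    exists (col_mx x (s' - dsubmx z)); last by rewrite LE col_mxKu col_mxKd.
    by rewrite /dom/= /F col_mxKu indicatorE// ltry.
  by rewrite opp_col_mx add_col_mx addrK subKr vsubmxK.
have [_ _ phic] := phiG.
have [||xi [pxi Fxi]] := @subgrad_sum _ _ _ F phi (Lbar l L) w0
  (col_mx (- (lam^-1 *: c)) 0) 0 (psi (L *m x)) FN phiN Fc phic Fw0 phiw0.
- move=> w a' b' /F_fin[Cw ->]; rewrite LE => /(psir_le phiG hA1).
  rewrite -/psi /w0 dot_vsub !col_mxKu !col_mxKd dot0l addr0 linearB/= col_mxKu.
  have := cP _ Cw; rewrite -(@pmulr_rge0 _ lam^-1) ?invr_gt0// mulrDr mulKf ?gt_eqF//.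
  by rewrite dotNl dotZl; lra.
- split; first exact: full.
  by apply: filterE => z _; exact: full.
pose rr := usubmx xi; pose rho := dsubmx xi.
have LtE : (Lbar l L)^T *m xi = col_mx (L^T *m rr) rho.
  rewrite -{1}[xi]vsubmxK tr_block_mx mul_block_col !trmx0 !mul0mx add0r addr0.
  by rewrite trmx1 mul1mx.
case: Fxi => a0 Fw0' Fsub; have /F_fin[_ a00] := Fw0'.
have {}Fsub z s' : C z -> dot (lam^-1 *: c + L^T *m rr) (z - x) + dot rho (s' - s) >= 0.
  move=> Cz; have := Fsub (col_mx z s') 0 _.
  rewrite /F col_mxKu indicatorE// => /(_ erefl).
  rewrite a00 add0r LtE /w0 !opp_col_mx !add_col_mx dot_col_mx sub0r dotNl -opprD.
  by rewrite dotNl; lra.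
(* The block s is unconstrained: moving it by - rho gives |rho|^2 <= 0. *)
have rho0 : rho = 0.
  apply/eqP; rewrite -dot_eq0 eq_le dot_ge0 andbT.
  have := Fsub x (s - rho) Cx.
  by rewrite subrr dot0r add0r addrAC subrr add0r dotNr oppr_ge0.
exists v, t, s, rr; split=> //; last first.
  rewrite LE /w0 col_mxKu col_mxKd in pxi.
  by rewrite -rho0 /rho /rr vsubmxK.
split=> // z Cz; have := Fsub z s Cz.
rewrite subrr dot0r addr0 -(pmulr_rge0 _ lam_gt0) dotDl dotZl mulrDr mulVKf ?gt_eqF//.
by rewrite /c !dot_forward dot0l mulr0 addr0 [dot (L^T *m rr) _]dot_mulmxl trmxK.
Qed.

End optimality.

(** * Averagedness of T in the metric of P *)

Section averagedness.
Variables (R : realType).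

(** Being al-averaged amounts to the step inequality with factor 1 / al - 1, and 1 / al = 2 - 1 /
    kappa. The nonexpansive operator is found by solving T = (1 - al) Id + al N for N. *)
Lemma averaged_of_step (V : lmodType R) (b : V -> V -> R) (T : V -> V) (kappa : R) :
  (forall u v w, b (u + v) w = b u w + b v w) ->
  (forall a u v, b (a *: u) v = a * b u v) ->
  (forall u v, b u v = b v u) ->
  1 < kappa ->
  (forall z w, let e := z - w - (T z - T w) in
     b (T z - T w) (T z - T w) + (1 - kappa^-1) * b e e <= b (z - w) (z - w)) ->
  averaged (ip_norm b) (kappa / (2 * kappa - 1)) T.
Proof.
move=> bD bZ bC k1 step.
have k0 : 0 < kappa by apply: lt_trans k1.
have c0 : 0 < 2 * kappa - 1 by lra.
set al := kappa / (2 * kappa - 1).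
have al0 : 0 < al by rewrite divr_gt0.
split; first by rewrite al0 /al ltr_pdivrMr// mul1r; lra.
have bN u v : b (- u) v = - b u v by rewrite -scaleN1r bZ mulN1r.
have bDr u v w : b u (v + w) = b u v + b u w by rewrite !(bC u) bD.
have bNr u v : b u (- v) = - b u v by rewrite !(bC u) bN.
have bZr a u v : b u (a *: v) = a * b u v by rewrite !(bC u) bZ.
exists (fun z => z - al^-1 *: (z - T z)); split=> [z w|z]; last first.
  rewrite scalerBr scalerA mulfV ?gt_eqF// scale1r addrA -scalerDl subrK scale1r.
  by rewrite subKr.
have -> : z - al^-1 *: (z - T z) - (w - al^-1 *: (w - T w)) =
    (z - w) - al^-1 *: (z - w - (T z - T w)).
  have subACA (x u v t : V) : x - u - (v - t) = x - v - (u - t).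
    by rewrite !opprD !opprK addrACA.
  by rewrite [LHS]subACA -scalerBr subACA.
pose D := z - w; pose e := D - (T z - T w).
have {}step : b (D - e) (D - e) + (1 - kappa^-1) * b e e <= b D D.
  by rewrite {1 2}/e subKr; exact: step.
rewrite -/D -/e; clearbody e; clearbody D.
rewrite /ip_norm; apply: ler_wsqrtr.
move: step; rewrite !(bD, bN, bDr, bNr, bZ, bZr) (bC e D).
have -> : al^-1 = 2 - kappa^-1 by rewrite /al; field; rewrite !gt_eqF.
have kV : kappa^-1 < 1 by rewrite invf_lt1.
move: (b D D) (b D e) (b e e) (kappa^-1) kV => DD De ee kV kV1 h.
have h1 : (2 - kV) * ee <= 2 * De by lra.
have b0 : 0 <= 2 - kV by lra.
have := ler_wpM2l b0 h1; lra.
Qed.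

End averagedness.

Lemma pair8_eq T1 T2 T3 T4 T5 T6 T7 T8 (a1 b1 : T1) (a2 b2 : T2) (a3 b3 : T3)
    (a4 b4 : T4) (a5 b5 : T5) (a6 b6 : T6) (a7 b7 : T7) (a8 b8 : T8) :
  a1 = b1 -> a2 = b2 -> a3 = b3 -> a4 = b4 -> a5 = b5 -> a6 = b6 -> a7 = b7 ->
  a8 = b8 -> (a1, a2, a3, a4, a5, a6, a7, a8) = (b1, b2, b3, b4, b5, b6, b7, b8).
Proof. by move=> -> -> -> -> -> -> -> ->. Qed.

Lemma pairZ (R : pzRingType) (U V : lmodType R) (a : R) (u : U) (v : V) :
  a *: (u, v) = (a *: u, a *: v).
Proof. by []. Qed.

Lemma pairD (U V : nmodType) (u u' : U) (v v' : V) :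
  (u, v) + (u', v') = (u + u', v + v').
Proof. by []. Qed.

Lemma pairB (U V : zmodType) (u u' : U) (v v' : V) :
  (u, v) - (u', v') = (u - u', v - v').
Proof. by []. Qed.

(** * The quadratic form of P *)

Section preconditioner.
Variables (R : realType) (d n m l q p : nat).
Variables (A : 'M[R]_(d, n)) (L : 'M[R]_(m, n)) (B : 'M[R]_(q, m)).
Variables (M : 'M[R]_(p, l)) (lam kappa gam1 gam2 gam3 gam4 : R).
Hypotheses (lam_gt0 : 0 < lam) (Q_psd : psdmx (Qmx A L B lam)).
Hypotheses (kappa_gt1 : 1 < kappa) (gam3_gt0 : 0 < gam3).
Hypothesis hgam1 : posdefmx (gam1^-1 *: 1%:M - (kappa / 2) *: (A^T *m A)
                       - lam *: (L^T *m L)).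
Hypothesis hgam2 : posdefmx (gam2^-1 *: 1%:M - 1%:M - M^T *m M).
Hypothesis hgam3 : (kappa / 2 + 2 / kappa) * opnorm B ^+ 2 <= gam3^-1.
Hypothesis hgam4 : posdefmx (gam4^-1 *: 1%:M - gam3 *: (M *m M^T)).

Notation H := (Hspace R n m l p).
Notation P := (Pop L B M lam gam1 gam2 gam3 gam4 : H -> H).

Lemma enorm_mulmx_le (v : 'cV[R]_m) : enorm (B *m v) <= opnorm B * enorm v.
Proof.
have Bsup : has_sup [set enorm (B *m u) | u in [set u : 'cV[R]_m | enorm u <= 1]].
  split; first by exists (enorm (B *m 0)), 0 => //=; rewrite /enorm dot0l sqrtr0.
  have [c c0 Bc] := mulmx_bounded B.
  exists (Num.sqrt (q%:R * (c * c))) => _ [u u1 <-]; rewrite ler_wsqrtr//.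
  apply: le_trans (ler_norm _) _; apply: le_trans (dot_le_normr _ _) _.
  rewrite ler_wpM2l//; have h : `|B *m u| <= c.
    apply: le_trans (Bc u) _; rewrite ler_piMr// (le_trans (normr_le_enorm _))//.
  by rewrite ler_pM.
have [->|v0] := eqVneq v 0; first by rewrite mulmx0 /enorm !dot0l sqrtr0 mulr0.
have ev : 0 < enorm v by rewrite sqrtr_gt0 dot_gt0.
rewrite -ler_pdivrMr//; apply: (sup_upper_bound Bsup).
have enZ N (a : R) (u : 'cV[R]_N) : 0 <= a -> enorm (a *: u) = a * enorm u.
  move=> a0; rewrite /enorm dotZl dotZr mulrA -expr2 sqrtrM ?sqr_ge0//.
  by rewrite sqrtr_sqr ger0_norm.
exists ((enorm v)^-1 *: v) => /=; last first.
  by rewrite -scalemxAr enZ 1?mulrC// invr_ge0 ltW.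
by rewrite enZ ?mulVf ?gt_eqF// invr_ge0 ltW.
Qed.

(** The form <z, P w> with the adjoints moved across, which makes its symmetry visible. *)
Definition pform (z w : H) : R :=
  let: (x, s, v, t, r, eta, xi, zeta) := z in
  let: (x', s', v', t', r', eta', xi', zeta') := w in
  gam1^-1 * dot x x'
  - lam * (dot (B *m (L *m x)) (B *m v') + dot (B *m v) (B *m (L *m x')))
  - lam * (dot (L *m x) r' + dot r (L *m x'))
  + lam * dot r r' + lam / gam3 * dot v v'
  + lam * (gam2^-1 * dot s s' - (dot s eta' + dot eta s')
    - (dot (M *m s) xi' + dot xi (M *m s')) + dot eta eta' + dot xi xi')
  + lam * (gam3^-1 * dot t t' - (dot (M *m t) zeta' + dot zeta (M *m t'))
    + gam4^-1 * dot zeta zeta').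

(* The form of the cocoercive part diag(Q, 0, lam B^T B, 0, ...) of the splitting *)
Definition dform (z w : H) : R :=
  let: (x, s, v, t, r, eta, xi, zeta) := z in
  let: (x', s', v', t', r', eta', xi', zeta') := w in
  dot (A *m x) (A *m x') - lam * dot (B *m (L *m x)) (B *m (L *m x'))
  + lam * dot (B *m v) (B *m v').

Lemma dotH_Pop z w : dotH z (P w) = pform z w.
Proof.
case: z w => [[[[[[[x s] v] t] r] eta] xi] zeta] [[[[[[[x' s'] v'] t'] r'] eta'] xi'] zeta'].
rewrite /dotH /Pop /pform -!mulmxA !(dotDr, dotNr, dotZr).
rewrite !(dot_mulmxr L^T) !(dot_mulmxr B^T) !(dot_mulmxr M^T) !trmxK.
ring.
Qed.

Lemma pformC z w : pform z w = pform w z.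
Proof.
case: z w => [[[[[[[x s] v] t] r] eta] xi] zeta] [[[[[[[x' s'] v'] t'] r'] eta'] xi'] zeta'].
rewrite /pform (dotC x x') (dotC r r') (dotC v v') (dotC s s') (dotC eta eta').
rewrite (dotC xi xi') (dotC t t') (dotC zeta zeta').
rewrite (dotC (B *m (L *m x))) (dotC (B *m v)) (dotC (L *m x)) (dotC r).
rewrite (dotC s) (dotC eta) (dotC (M *m s)) (dotC xi) (dotC (M *m t)) (dotC zeta).
ring.
Qed.

Lemma dform_ge0 z : 0 <= dform z z.
Proof.
case: z => [[[[[[[x s] v] t] r] eta] xi] zeta]; rewrite /dform.
by rewrite addr_ge0 ?Q_dot// mulr_ge0 ?dot_ge0// ltW.
Qed.

(** Origin of the bound on gam3: [dform] takes away kappa / 2 |B v|^2, but its concave part frees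
    kappa / 2 |B L x|^2, which absorbs the cross term of B L x and B v at the price 2 / kappa |B
    v|^2. The weight gam3 in the condition on gam4 comes from completing the square in t. *)
Lemma pform_dform z : z != 0 -> kappa / 2 * dform z z < pform z z.
Proof.
case: z => [[[[[[[x s] v] t] r] eta] xi] zeta] z0.
have k0 : 0 < kappa by apply: lt_trans kappa_gt1.
have scal N (c : R) (u : 'cV[R]_N) : dot u ((c *: 1%:M) *m u) = c * dot u u.
  by rewrite -scalemxAl mul1mx dotZr.
have G1 : x != 0 -> 0 < gam1^-1 * dot x x - kappa / 2 * dot (A *m x) (A *m x)
    - lam * dot (L *m x) (L *m x).
  have [_ h] := hgam1; move=> /h; rewrite !mulmxBl !dotBr scal -!scalemxAl !dotZr.
  by rewrite -!mulmxA (dot_mulmxr A^T) (dot_mulmxr L^T) !trmxK.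
have G2 : s != 0 -> 0 < gam2^-1 * dot s s - dot s s - dot (M *m s) (M *m s).
  have [_ h] := hgam2; move=> /h; rewrite !mulmxBl !dotBr scal mul1mx.
  by rewrite -!mulmxA (dot_mulmxr M^T) !trmxK.
have G4 : zeta != 0 -> 0 < gam4^-1 * dot zeta zeta
    - gam3 * dot (M^T *m zeta) (M^T *m zeta).
  have [_ h] := hgam4; move=> /h; rewrite !mulmxBl !dotBr scal -scalemxAl dotZr.
  by rewrite -mulmxA (dot_mulmxr M).
have G1w : 0 <= gam1^-1 * dot x x - kappa / 2 * dot (A *m x) (A *m x)
    - lam * dot (L *m x) (L *m x).
  by have [->|/G1/ltW//] := eqVneq x 0; rewrite !mulmx0 !dot0l !mulr0 !subr0.
have G2w : 0 <= gam2^-1 * dot s s - dot s s - dot (M *m s) (M *m s).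
  by have [->|/G2/ltW//] := eqVneq s 0; rewrite !mulmx0 !dot0l !mulr0 !subr0.
have G4w : 0 <= gam4^-1 * dot zeta zeta - gam3 * dot (M^T *m zeta) (M^T *m zeta).
  by have [->|/G4/ltW//] := eqVneq zeta 0; rewrite !mulmx0 !dot0l !mulr0 !subr0.
have G3 : (kappa / 2 + 2 / kappa) * dot (B *m v) (B *m v) <= gam3^-1 * dot v v.
  have c0 : 0 <= kappa / 2 + 2 / kappa by rewrite addr_ge0// divr_ge0// ltW.
  apply: le_trans (ler_wpM2r (dot_ge0 v) hgam3); rewrite -mulrA ler_wpM2l//.
  rewrite -!enormK -exprMn ler_pXn2r ?nnegrE ?enorm_ge0 ?enorm_mulmx_le//.
  by rewrite (le_trans (enorm_ge0 (B *m v)) (enorm_mulmx_le v)).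
(* completing the squares; the last bracket is a perfect square *)
have gapE : pform (x, s, v, t, r, eta, xi, zeta) (x, s, v, t, r, eta, xi, zeta)
  - kappa / 2 * dform (x, s, v, t, r, eta, xi, zeta) (x, s, v, t, r, eta, xi, zeta)
  = (gam1^-1 * dot x x - kappa / 2 * dot (A *m x) (A *m x)
     - lam * dot (L *m x) (L *m x))
  + lam * (dot (r - L *m x) (r - L *m x)
    + (gam2^-1 * dot s s - dot s s - dot (M *m s) (M *m s))
    + dot (eta - s) (eta - s) + dot (xi - M *m s) (xi - M *m s)
    + gam3^-1 * dot (t - gam3 *: (M^T *m zeta)) (t - gam3 *: (M^T *m zeta))
    + (gam4^-1 * dot zeta zeta - gam3 * dot (M^T *m zeta) (M^T *m zeta))
    + (gam3^-1 * dot v v - (kappa / 2 + 2 / kappa) * dot (B *m v) (B *m v))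
    + kappa / 2 * dot (B *m (L *m x) - (2 / kappa) *: (B *m v))
                      (B *m (L *m x) - (2 / kappa) *: (B *m v))).
  rewrite /pform /dform !(dotBl, dotBr, dotZl, dotZr).
  rewrite (dotC (L *m x) r) (dotC s eta) (dotC (M *m s) xi).
  rewrite (dot_mulmxr M^T) (dotC (M^T *m zeta) t) (dot_mulmxr M^T) !trmxK.
  rewrite (dotC (M *m t) zeta) (dotC (B *m v)).
  move: (gam1^-1) (gam2^-1) (gam4^-1) => g1 g2 g4.
  by field; rewrite !gt_eqF.
have g3V : 0 < gam3^-1 by rewrite invr_gt0.
have k2 : 0 < kappa / 2 by rewrite divr_gt0.
rewrite -subr_gt0 gapE ltNge; apply/negP.
have v1 := dot_ge0 (r - L *m x); have v2 := dot_ge0 (eta - s).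
have v3 := dot_ge0 (xi - M *m s).
have v4 := mulr_ge0 (ltW g3V) (dot_ge0 (t - gam3 *: (M^T *m zeta))).
have v5 := mulr_ge0 (ltW k2) (dot_ge0 (B *m (L *m x) - (2 / kappa) *: (B *m v))).
have v6 : 0 <= gam3^-1 * dot v v - (kappa / 2 + 2 / kappa) * dot (B *m v) (B *m v).
  by rewrite subr_ge0.
have sum_eq0 (a1 a2 a3 a4 a5 a6 a7 a8 : R) : 0 <= a1 -> 0 <= a2 -> 0 <= a3 ->
    0 <= a4 -> 0 <= a5 -> 0 <= a6 -> 0 <= a7 -> 0 <= a8 ->
    forall a0, 0 <= a0 ->
    a0 + lam * (a1 + a2 + a3 + a4 + a5 + a6 + a7 + a8) <= 0 ->
    [/\ a0 = 0, a1 = 0, a2 = 0, a3 = 0 &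
     [/\ a4 = 0, a5 = 0, a6 = 0, a7 = 0 & a8 = 0]].
  move=> h1 h2 h3 h4 h5 h6 h7 h8 a0 h0 le0.
  have S0 : 0 <= lam * (a1 + a2 + a3 + a4 + a5 + a6 + a7 + a8).
    by rewrite mulr_ge0 ?(ltW lam_gt0)// !addr_ge0.
  have : a0 + lam * (a1 + a2 + a3 + a4 + a5 + a6 + a7 + a8) == 0.
    by rewrite eq_le le0 addr_ge0.
  rewrite paddr_eq0// mulf_eq0 (gt_eqF lam_gt0)/= !paddr_eq0 ?addr_ge0//.
  move=> /andP[/eqP e0 /andP[/andP[/andP[/andP[/andP[/andP[/andP[]]]]]]]].
  by do 8!move=> /eqP ?.
(* If the gap is not positive, every summand vanishes. The strict conditions give x, s and zeta, the
   squares then give r, eta, xi and t. The bound on gam3 is not strict, so v takes two summands: the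
   last square gives B v = 0, and then |v|^2 / gam3 = 0. *)
move=> /(sum_eq0 _ _ _ _ _ _ _ _ v1 G2w v2 v3 v4 G4w v6 v5 _ G1w).
move=> [x0 r0 s0 eta0 [xi0 t0 zeta0 v0 Bv0]].
have zero N (u : 'cV[R]_N) : dot u u = 0 -> u = 0.
  by move=> u0; apply/eqP; rewrite -dot_eq0 u0.
have {}x0 : x = 0 by have [//|/G1] := eqVneq x 0; rewrite x0 ltxx.
have {}s0 : s = 0 by have [//|/G2] := eqVneq s 0; rewrite s0 ltxx.
have {}zeta0 : zeta = 0 by have [//|/G4] := eqVneq zeta 0; rewrite zeta0 ltxx.
have {}r0 : r = 0 by move: (zero _ _ r0); rewrite x0 mulmx0 subr0.
have {}eta0 : eta = 0 by move: (zero _ _ eta0); rewrite s0 subr0.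
have {}xi0 : xi = 0 by move: (zero _ _ xi0); rewrite s0 mulmx0 subr0.
have {}t0 : t = 0.
  by move/eqP: t0; rewrite mulf_eq0 gt_eqF//= => /eqP/zero; rewrite zeta0 mulmx0 scaler0 subr0.
have {}Bv0 : B *m v = 0.
  move/eqP: Bv0; rewrite mulf_eq0 gt_eqF//= => /eqP/zero/eqP.
  rewrite x0 !mulmx0 sub0r oppr_eq0 scaler_eq0 => /orP[|/eqP //].
  by rewrite gt_eqF// divr_gt0.
have {}v0 : v = 0.
  by move: v0; rewrite Bv0 dot0l mulr0 subr0 => /eqP; rewrite mulf_eq0 gt_eqF//= => /eqP/zero.
by move: z0; rewrite x0 s0 v0 t0 r0 eta0 xi0 zeta0 eqxx.
Qed.

Lemma pform_gt0 z : z != 0 -> 0 < pform z z.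
Proof.
move=> /pform_dform; apply: le_lt_trans.
by rewrite mulr_ge0 ?dform_ge0// divr_ge0// ltW// (lt_trans ltr01).
Qed.

Lemma pform0 : pform 0 0 = 0.
Proof. by rewrite /pform /= !mulmx0 !dot0l; ring. Qed.

Lemma pform_ge z : kappa / 2 * dform z z <= pform z z.
Proof.
have [->|/pform_dform/ltW//] := eqVneq z 0.
by rewrite pform0 /dform /= !mulmx0 !dot0l !mulr0 subr0 addr0 mulr0.
Qed.

Lemma pformDl z z' w : pform (z + z') w = pform z w + pform z' w.
Proof.
move: z z' w => [[[[[[[x s] v] t] r] eta] xi] zeta].
move=> [[[[[[[x' s'] v'] t'] r'] eta'] xi'] zeta'].
move=> [[[[[[[x2 s2] v2] t2] r2] eta2] xi2] zeta2].
by rewrite /pform /= !mulmxDr !dotDl; ring.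
Qed.

Lemma pformZl a z w : pform (a *: z) w = a * pform z w.
Proof.
move: z w => [[[[[[[x s] v] t] r] eta] xi] zeta].
move=> [[[[[[[x' s'] v'] t'] r'] eta'] xi'] zeta'].
by rewrite /pform /= -!scalemxAr !dotZl; ring.
Qed.

Lemma dotHC (z w : H) : dotH z w = dotH w z.
Proof.
move: z w => [[[[[[[x s] v] t] r] eta] xi] zeta].
move=> [[[[[[[x' s'] v'] t'] r'] eta'] xi'] zeta'].
rewrite /dotH (dotC x) (dotC s) (dotC v) (dotC t) (dotC r) (dotC eta) (dotC xi).
by rewrite (dotC zeta).
Qed.

Lemma Pop_linear : linear P.
Proof.
move=> a [[[[[[[x s] v] t] r] eta] xi] zeta] [[[[[[[x' s'] v'] t'] r'] eta'] xi'] zeta'].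
rewrite /Pop /= !mulmxDr -!scalemxAr.
rewrite !(pairZ, pairD).
by apply: pair8_eq; apply/colP => i; rewrite !mxE; ring.
Qed.

Lemma posdefop_Pop : posdefop (@dotH R n m l p) P.
Proof.
split; first exact: Pop_linear.
  by move=> z w; rewrite dotHC !dotH_Pop pformC.
by move=> z z0; rewrite dotH_Pop; exact: pform_gt0.
Qed.

(** With dz = hz + e, expanding the left-hand square leaves the cross term 2 [pform e hz], which
    monotonicity bounds below by - [pform e e] / kappa. *)
Lemma pform_step (dz hz : H) :
  dform dz hz <= pform (dz - hz) hz ->
  pform hz hz + (1 - kappa^-1) * pform (dz - hz) (dz - hz) <= pform dz dz.
Proof.
have k0 : 0 < kappa by apply: lt_trans kappa_gt1.
have -> : dz = hz + (dz - hz) by rewrite addrC subrK.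
move: (dz - hz) => e; rewrite addrAC subrr add0r => mono.
have dC u v : dform u v = dform v u.
  case: u v => [[[[[[[x s] v] t] r] eta] xi] zeta] [[[[[[[x' s'] v'] t'] r'] eta'] xi'] zeta'].
  by rewrite /dform (dotC (A *m x)) (dotC (B *m v)) (dotC (B *m (L *m x))).
have dDl u v w : dform (u + v) w = dform u w + dform v w.
  move: u v w => [[[[[[[x s] v] t] r] eta] xi] zeta].
  move=> [[[[[[[x' s'] v'] t'] r'] eta'] xi'] zeta'].
  move=> [[[[[[[x2 s2] v2] t2] r2] eta2] xi2] zeta2].
  by rewrite /dform /= !mulmxDr !dotDl; ring.
have dZl a u w : dform (a *: u) w = a * dform u w.
  move: u w => [[[[[[[x s] v] t] r] eta] xi] zeta].
  move=> [[[[[[[x' s'] v'] t'] r'] eta'] xi'] zeta'].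
  by rewrite /dform /= -!scalemxAr !dotZl; ring.
(* dform (hz + e) hz >= - dform e e / 4 >= - pform e e / (2 kappa) *)
have := dform_ge0 (hz + 2^-1 *: e).
have := pform_ge e.
rewrite !dDl (dC hz (_ + _)) (dC (2^-1 *: e) (_ + _)) !dDl !dZl.
rewrite (dC hz (2^-1 *: e)) (dC e (2^-1 *: e)) !dZl.
rewrite !pformDl (pformC hz (_ + _)) (pformC e (_ + _)) !pformDl (pformC hz e).
rewrite dDl in mono.
move: (dform hz hz) (dform e hz) (dform e e) (pform e e) (pform e hz) (pform hz hz) mono.
move=> dhh deh dee pee peh phh mono h1 h2.
have : kappa^-1 * (kappa / 2 * dee) <= kappa^-1 * pee by rewrite ler_wpM2l// invr_ge0 ltW.
rewrite !mulrA mulVf ?gt_eqF// mul1r; lra.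
Qed.

End preconditioner.

(** * Monotonicity of one step of T *)

Section monotone_step.
Variables (R : realType) (d n m l q p : nat).
Variables (A : 'M[R]_(d, n)) (y : 'cV[R]_d) (L : 'M[R]_(m, n)) (B : 'M[R]_(q, m)).
Variables (M : 'M[R]_(p, l)) (lam : R) (C : set 'cV[R]_n).
Variables (f : 'cV[R]_(m + l) -> \bar R) (g : 'cV[R]_p -> \bar R).
Variables (gam1 gam2 gam3 gam4 : R).
Hypotheses (C_neq0 : C !=set0) (C_closed : closed C) (C_convex : convex_set C).
Hypotheses (fG : Gamma0 f) (gG : Gamma0 g) (lam_gt0 : 0 < lam).
Hypotheses (gam1_gt0 : 0 < gam1) (gam2_gt0 : 0 < gam2).
Hypotheses (gam3_gt0 : 0 < gam3) (gam4_gt0 : 0 < gam4).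

Notation H := (Hspace R n m l p).
Notation T := (Top A y L B M lam C f g gam1 gam2 gam3 gam4 : H -> H).
Notation pform := (pform L B M lam gam1 gam2 gam3 gam4).
Notation dform := (dform A L B lam).

(** A regrouping by inclusions: since [TopP] is affine in (z, z'), each bracket is the pairing of
    differences belonging to one of its lines. *)
Lemma pform_dform_split (x x' : 'cV[R]_n) (s s' t t' eta eta' : 'cV[R]_l)
    (v v' r r' : 'cV[R]_m) (xi xi' zeta zeta' : 'cV[R]_p) :
  pform (x - x', s - s', v - v', t - t', r - r', eta - eta', xi - xi', zeta - zeta')
        (x', s', v', t', r', eta', xi', zeta')
  - dform (x, s, v, t, r, eta, xi, zeta) (x', s', v', t', r', eta', xi', zeta')
  = (gam1^-1 * dot (x - x') x' - dot (A *m x) (A *m x')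
     + lam * dot (B *m (L *m x - v)) (B *m (L *m x')) - lam * dot r (L *m x'))
  + lam * ((gam2^-1 * dot (s - s') s' - dot eta s' - dot xi (M *m s'))
  + (gam3^-1 * dot (v - v') v' + dot (B *m (L *m (2 *: x' - x) - v)) (B *m v')
     + (gam3^-1 * dot (t - t') t' - dot zeta (M *m t')))
  + (dot (r - r' + L *m (2 *: x' - x)) r' + dot (eta - eta' + (2 *: s' - s)) eta')
  + dot (xi - xi' + M *m (2 *: s' - s)) xi'
  + (gam4^-1 * dot (zeta - zeta') zeta' + dot (M *m (2 *: t' - t)) zeta')).
Proof.
rewrite /pform /dform !(mulmxDr, mulmxN) -!scalemxAr ?(mulmxDr, mulmxN).
rewrite -?scalemxAr !(dotDl, dotNl, dotZl).
rewrite (dotC (B *m v') (B *m (L *m x'))) (dotC r' (L *m x')) (dotC eta' s').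
rewrite (dotC xi' (M *m s')) (dotC zeta' (M *m t')).
ring.
Qed.

(** Each bracket of the split is the monotonicity of one subdifferential; the one for x adds the two
    variational inequalities, each tested at the other projection, and the one for s vanishes
    because its update is an equation. The gradient is taken at the old point, hence z - w in
    [dform]. *)
Lemma Top_monotone (z w : H) :
  dform (z - w) (T z - T w) <= pform (z - w - (T z - T w)) (T z - T w).
Proof.
move: z w => [[[[[[[x1 s1] v1] t1] r1] e1] xi1] ze1] [[[[[[[x2 s2] v2] t2] r2] e2] xi2] ze2].
case E1 : (T (x1, s1, v1, t1, r1, e1, xi1, ze1)) =>
  [[[[[[[x1' s1'] v1'] t1'] r1'] e1'] xi1'] ze1'].
case E2 : (T (x2, s2, v2, t2, r2, e2, xi2, ze2)) =>
  [[[[[[[x2' s2'] v2'] t2'] r2'] e2'] xi2'] ze2'].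
have [[Cx1 P1] S1 [V1 F1 G1 Z1]] := (TopP A y L B M lam gam2 C_neq0 C_closed C_convex fG gG
  gam1_gt0 gam3_gt0 gam4_gt0 _ _ _ _ _ _ _ _ _ _ _ _ _ _ _ _).1 E1.
have [[Cx2 P2] S2 [V2 F2 G2 Z2]] := (TopP A y L B M lam gam2 C_neq0 C_closed C_convex fG gG
  gam1_gt0 gam3_gt0 gam4_gt0 _ _ _ _ _ _ _ _ _ _ _ _ _ _ _ _).1 E2.
rewrite !pairB -subr_ge0 pform_dform_split.
apply: addr_ge0.
  have := P1 _ Cx2; have := P2 _ Cx1.
  rewrite !(dotBl (_ *: _)) !dotZl !dot_forward.
  rewrite -(opprB x1' x2') !mulmxN !dotNr.
  set e := x1' - x2'.
  rewrite (_ : L *m (x1 - x2) - (v1 - v2) = (L *m x1 - v1) - (L *m x2 - v2)); last first.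
    by rewrite mulmxBr !opprD !opprK addrACA.
  rewrite (_ : x1 - x2 - e = (x1 - x1') - (x2 - x2')); last first.
    by rewrite /e !opprD !opprK addrACA.
  rewrite [A *m (x1 - x2)]mulmxBr [B *m (_ - (_ - v2))]mulmxBr !dotBl.
  by lra.
have eq_ge0 (a b : R) : a = b -> 0 <= a -> 0 <= b by move=> ->.
have monof := subgrad_mono V1 V2; have monoF := subgrad_mono F1 F2.
have monog := subgrad_mono G1 G2; have monoz := subgrad_mono Z1 Z2.
apply: mulr_ge0; first exact: ltW.
have sE : gam2^-1 * dot (s1 - s2 - (s1' - s2')) (s1' - s2') - dot (e1 - e2) (s1' - s2')
    - dot (xi1 - xi2) (M *m (s1' - s2')) = 0.
  have -> : s1 - s2 - (s1' - s2') = gam2 *: (e1 - e2 + M^T *m (xi1 - xi2)).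
    by rewrite S1 S2 mulmxBr; apply/colP => i; rewrite !mxE; ring.
  rewrite dotZl mulKf ?gt_eqF// dotDl dot_mulmxl trmxK; ring.
rewrite sE add0r; apply: addr_ge0; first (apply: addr_ge0; first apply: addr_ge0).
- move: monof; rewrite !opp_col_mx !add_col_mx dot_col_mx.
  have -> : gam3^-1 *: (v1 - v1') + B^T *m (B *m (L *m (2 *: x1' - x1) - v1)) -
      (gam3^-1 *: (v2 - v2') + B^T *m (B *m (L *m (2 *: x2' - x2) - v2))) =
      gam3^-1 *: (v1 - v2 - (v1' - v2')) + B^T *m (B *m
        (L *m (2 *: (x1' - x2') - (x1 - x2)) - (v1 - v2))).
    by rewrite !(scalerDr, scalerN, mulmxDr, mulmxN) -!scalemxAr; apply/colP => i; rewrite !mxE; ring.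
  have -> : gam3^-1 *: (t1 - t1') - M^T *m ze1 - (gam3^-1 *: (t2 - t2') - M^T *m ze2) =
      gam3^-1 *: (t1 - t2 - (t1' - t2')) - M^T *m (ze1 - ze2).
    by rewrite mulmxBr; apply/colP => i; rewrite !mxE; ring.
  by rewrite (dotDl (_ *: _)) (dotBl (_ *: _)) !dotZl (dot_mulmxl B^T) (dot_mulmxl M^T) !trmxK.
- move: monoF; rewrite !opp_col_mx !add_col_mx dot_col_mx (dotC (r1' - r2')).
  rewrite (dotC (e1' - e2')) => h; apply: (eq_ge0 _ _ _ h); congr (_ + _); congr (dot _ _).
    by rewrite !(scalerDr, scalerN, mulmxDr, mulmxN) -!scalemxAr; apply/colP => i; rewrite !mxE; ring.
  by apply/colP => i; rewrite !mxE; ring.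
- move: monog; rewrite dotC => h; apply: (eq_ge0 _ _ _ h); congr (dot _ _).
  by rewrite !(scalerDr, scalerN, mulmxDr, mulmxN) -!scalemxAr; apply/colP => i; rewrite !mxE; ring.
- move: monoz; rewrite dotC -dotZl -dotDl => h; apply: (eq_ge0 _ _ _ h); congr (dot _ _).
  by rewrite !(scalerDr, scalerN, mulmxDr, mulmxN) -!scalemxAr; apply/colP => i; rewrite !mxE; ring.
Qed.

End monotone_step.


(** * Krasnoselskii-Mann iteration *)

Section km.
Variables (R : realType) (V : normedModType R) (b : V -> V -> R).
Hypotheses (bZ : forall a u v, b (a *: u) v = a * b u v) (bC : forall u v, b u v = b v u).
Hypothesis b_gt0 : forall z, z != 0 -> 0 < b z z.
Hypothesis compact_ball : forall r, compact [set z : V | `|z| <= r].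
Hypothesis b_continuous : continuous (fun z => b z z).

(** The minimum of q over the unit sphere, extended by homogeneity. The implication in front of |z0|
    = 1 covers the zero space, which has no unit vector. *)
Lemma homogeneous_extremum (q : V -> R) : continuous q ->
  (forall a z, q (a *: z) = a ^+ 2 * q z) ->
  exists2 z0 : V, (exists z : V, z != 0) -> `|z0| = 1 & forall z, q z0 * `|z| ^+ 2 <= q z.
Proof.
move=> cq qZ.
have q0 : q 0 = 0 by rewrite -(scale0r 0) qZ expr0n mul0r.
have [[z1 z1N0]|triv] := pselect (exists z : V, z != 0); last first.
  exists 0 => [//|z]; have [->|zN0] := eqVneq z 0; first by rewrite q0 mul0r.
  by exfalso; apply: triv; exists z.
have unit (z : V) : z != 0 -> `| `|z|^-1 *: z| = 1.
  by move=> zN0; rewrite normrZ normfV normr_id mulVf// normr_eq0.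
have cS : compact [set z : V | `|z| = 1].
  apply: subclosed_compact (@compact_ball 1) _; last by move=> z /= ->.
  rewrite (_ : mkset _ = Num.Def.normr @^-1` [set 1])//.
  by apply: closed_comp => [z _|]; [exact: norm_continuous|exact: closed_eq].
have lq : lower_semicontinuous (fun z => (q z)%:E).
  move=> x a; rewrite lte_fin => ax; exists [set z | a < q z] => //.
  by apply: (cvgr_gt (q x)) => //; exact: cq.
have [||z0 z01 zmin] := lsc_attains_compact cS _ lq.
- by exists (`|z1|^-1 *: z1); exact: unit.
- by [].
exists z0 => [_|z]; first exact: z01.
have [->|zN0] := eqVneq z 0; first by rewrite q0 normr0 expr0n mulr0.
by have := zmin _ (unit _ zN0); rewrite lee_fin qZ exprVn mulrC ler_pdivlMr ?exprn_gt0 ?normr_gt0.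
Qed.

Let q z := b z z.

Let bN u v : b (- u) v = - b u v.
Proof. by rewrite -scaleN1r bZ mulN1r. Qed.

Let qZ a z : q (a *: z) = a ^+ 2 * q z.
Proof. by rewrite /q bZ bC bZ mulrA -expr2. Qed.

Let q00 : q 0 = 0.
Proof. by have := qZ 0 0; rewrite scale0r expr0n mul0r. Qed.

Let q_lower : exists2 c : R, 0 < c & forall z, c * `|z| ^+ 2 <= q z.
Proof.
have [z0 z01 zmin] := homogeneous_extremum b_continuous qZ.
have [ex|triv] := pselect (exists z : V, z != 0).
  exists (q z0) => //; apply: b_gt0; rewrite -normr_gt0 z01//.
exists 1 => // z; have [->|zN0] := eqVneq z 0.
  by rewrite normr0 expr0n mulr0 q00.
by exfalso; apply: triv; exists z.
Qed.

Let cvg_of_q (I : Type) (F : set_system I) {FF : Filter F} (u : I -> V) :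
  q (u i) @[i --> F] --> (0 : R) -> u @ F --> (0 : V).
Proof.
move=> qu; have [c c0 cq] := q_lower.
apply/cvgrPdist_lt => e e0.
have : \forall i \near F, q (u i) < c * e ^+ 2.
  by apply: (cvgr_lt (0 : R)) => //; rewrite mulr_gt0// exprn_gt0.
apply: filterS => i /(le_lt_trans (cq _)); rewrite ltr_pM2l// sub0r normrN.
by rewrite ltr_pXn2r// nnegrE// ltW.
Qed.

Let q_of_cvg (I : Type) (F : set_system I) {FF : Filter F} (u : I -> V) :
  u @ F --> (0 : V) -> q (u i) @[i --> F] --> (0 : R).
Proof.
move=> u0; rewrite -q00.
by apply: continuous_cvg => //; exact: b_continuous.
Qed.

Theorem krasnoselskii_mann (T : V -> V) (k : R) zs z0 :
  0 < k -> T zs = zs ->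
  (forall z w, let e := z - w - (T z - T w) in
     b (T z - T w) (T z - T w) + k * b e e <= b (z - w) (z - w)) ->
  exists2 zf, T zf = zf & iter j T z0 @[j --> \oo] --> zf.
Proof.
move=> k0 fixs step; pose z j := iter j T z0.
have q0 w : 0 <= q w.
  have [c c0 cq] := q_lower; apply: le_trans (cq w).
  by rewrite mulr_ge0 ?exprn_ge0// ltW.
have nonexp u w : q (T u - T w) <= q (u - w).
  by apply: le_trans (step u w); rewrite /q lerDl mulr_ge0 ?(ltW k0)//; exact: q0.
have dec w j : T w = w -> q (z j.+1 - w) + k * q (z j - z j.+1) <= q (z j - w).
  move=> Tw; have := step (z j) w; rewrite /= Tw -/(z j.+1) -/q.
  by rewrite opprB addrA subrK.
have mono w : T w = w -> cvgn (fun j => q (z j - w)).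
  move=> Tw; apply: nonincreasing_is_cvgn.
    apply/nonincreasing_seqP => j; apply: le_trans (dec w j Tw).
    by rewrite lerDl mulr_ge0// ltW.
  by exists 0 => _ [j _ <-].
have res0 : q (z j - z j.+1) @[j --> \oo] --> (0 : R).
  have cv := mono _ fixs.
  have dif : k^-1 * (q (z j - zs) - q (z j.+1 - zs)) @[j --> \oo] --> (0 : R).
    have : k^-1 * (q (z j - zs) - q (z j.+1 - zs)) @[j --> \oo] -->
        k^-1 * (limn (fun j => q (z j - zs)) - limn (fun j => q (z j - zs))).
      apply: cvgM; first exact: cvg_cst.
      by apply: cvgB => //; rewrite (cvg_shiftS (fun j => q (z j - zs))).
    by rewrite subrr mulr0.
  apply: (squeeze_cvgr _ (cvg_cst 0) dif); near=> j.
  by rewrite q0/= ler_pdivlMl// lerBrDr addrC; exact: dec.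
have [c c0 cq] := q_lower.
have bnd j : `|z j| <= Num.sqrt (q (z0 - zs) / c) + `|zs|.
  have qj : q (z j - zs) <= q (z0 - zs).
    elim: j => // j; apply: le_trans; apply: le_trans (dec _ j fixs).
    by rewrite lerDl mulr_ge0// ltW.
  rewrite -[z j in leLHS](subrK zs) (le_trans (ler_normD _ _))// lerD2r.
  rewrite -[leLHS]ger0_norm// -sqrtr_sqr ler_wsqrtr// ler_pdivlMr// mulrC.
  exact: le_trans (cq _) qj.
have [U UU Uoo] := eventually_ultra.
have [zf _ zzf] : exists2 x, [set x | `|x| <= Num.sqrt (q (z0 - zs) / c) + `|zs|] x & z @ U --> x.
  by apply: compact_ultra_lim => //; near=> j; exact: bnd.
have zzf0 : (z j - zf) @[j --> U] --> (0 : V).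
  by rewrite -[X in _ --> X](subrr zf); apply: cvgB => //; exact: cvg_cst.
have resU : (z j - z j.+1) @[j --> U] --> (0 : V).
  apply: cvg_of_q; apply: cvg_trans res0.
  exact: cvg_app.
have Tzf0 : (z j.+1 - T zf) @[j --> U] --> (0 : V).
  apply: cvg_of_q; apply: (squeeze_cvgr _ (cvg_cst 0) (q_of_cvg zzf0)).
  by near=> j; rewrite q0 nonexp.
(* The constant T zf - zf is written as a combination of three sequences tending to 0 along U. *)
have fixf : T zf = zf.
  have h : (z j - zf) - (z j - z j.+1) - (z j.+1 - T zf) @[j --> U] --> (0 : V).
    rewrite -[X in _ --> X](subrr (0 - 0 : V)) {2}subr0.
    by apply: cvgB => //; apply: cvgB.
  have hE : (fun j => (z j - zf) - (z j - z j.+1) - (z j.+1 - T zf)) = fun=> T zf - zf.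
    apply/funext => j; rewrite opprB (addrC (z j - zf)) addrA subrK opprB.
    by rewrite [LHS]addrC addrA subrK.
  apply/eqP; rewrite -subr_eq0; apply/eqP.
  rewrite hE in h; exact: (cvg_unique _ (cvg_cst (T zf - zf)) h).
exists zf => //.
(* The limit along all j exists by monotonicity; U refines that filter, so it can be computed along
   U, where it is 0. *)
have zfq : q (z j - zf) @[j --> \oo] --> (0 : R).
  have lU : q (z j - zf) @[j --> U] --> limn (fun j => q (z j - zf)).
    by apply: cvg_trans (mono _ fixf); exact: cvg_app.
  have l0 : limn (fun j => q (z j - zf)) = 0 := cvg_unique _ lU (q_of_cvg zzf0).
  have loo : q (z j - zf) @[j --> \oo] --> limn (fun j => q (z j - zf)) := mono _ fixf.
  by rewrite l0 in loo.
have h : (z j - zf) @[j --> \oo] --> (0 : V) by apply: cvg_of_q zfq.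
rewrite -[zf]add0r (_ : (fun j => iter j T z0) = (fun j => (z j - zf) + zf)).
  by apply: cvgD => //; exact: cvg_cst.
by apply/funext => j; rewrite subrK.
Unshelve. all: by end_near. Qed.

End km.

(** * Topology of the product space *)

Section topology.
Variables (R : realType) (n m l q p : nat).

Lemma compact_ball_prod (U V : normedModType R) (r : R) :
  compact [set u : U | `|u| <= r] -> compact [set v : V | `|v| <= r] ->
  compact [set z : U * V | `|z| <= r].
Proof.
move=> cU cV; rewrite (_ : mkset _ = [set u : U | `|u| <= r] `*` [set v : V | `|v| <= r]).
  exact: compact_setX.
by apply/seteqP; split=> -[u v]; rewrite /= prod_normE/= ge_max => /andP.
Qed.

Lemma compact_ball_Hspace (r : R) : compact [set z : Hspace R n m l p | `|z| <= r].
Proof.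
by do 7!(apply: compact_ball_prod; last exact: compact_ball_cV); exact: compact_ball_cV.
Qed.

Let fst_continuous (U V : normedModType R) : continuous (@fst U V).
Proof. by move=> z; exact: cvg_fst. Qed.

Let snd_continuous (U V : normedModType R) : continuous (@snd U V).
Proof. by move=> z; exact: cvg_snd. Qed.

Let cts (V : normedModType R) (h : Hspace R n m l p -> V) := continuous h.

Let cts_fst (U V : normedModType R) (h : Hspace R n m l p -> U * V) :
  cts h -> cts (fun z => (h z).1).
Proof.
move=> ch z; apply: (@continuous_cvg _ _ _ (nbhs z) _ h fst); last exact: ch.
exact: fst_continuous.
Qed.

Let cts_snd (U V : normedModType R) (h : Hspace R n m l p -> U * V) :
  cts h -> cts (fun z => (h z).2).
Proof.
move=> ch z; apply: (@continuous_cvg _ _ _ (nbhs z) _ h snd); last exact: ch.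
exact: snd_continuous.
Qed.

Let cts1 : cts (fun z => z.1).
Proof. exact: fst_continuous. Qed.

Let cts2 : cts (fun z => z.2).
Proof. exact: snd_continuous. Qed.

Let cts_mulmx m' n' (K : 'M[R]_(m', n')) (h : Hspace R n m l p -> 'cV[R]_n') :
  cts h -> cts (fun z => K *m h z).
Proof.
move=> ch z; apply: (@continuous_cvg _ _ _ (nbhs z) _ h (mulmx K)); last exact: ch.
exact: mulmx_continuous.
Qed.

Let cts_dot N (h k : Hspace R n m l p -> 'cV[R]_N) :
  cts h -> cts k -> cts (fun z => dot (h z) (k z)).
Proof. by move=> ch ck z; apply: dot_cvg; [exact: ch|exact: ck]. Qed.

Let cts_cM (c : R) (h : Hspace R n m l p -> R) : cts h -> cts (fun z => c * h z).
Proof. by move=> ch z; apply: cvgM; [exact: cvg_cst|exact: ch]. Qed.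

Let cts_D (h k : Hspace R n m l p -> R) :
  cts h -> cts k -> cts (fun z => h z + k z).
Proof. by move=> ch ck z; apply: cvgD; [exact: ch|exact: ck]. Qed.

Let cts_N (h : Hspace R n m l p -> R) : cts h -> cts (fun z => - h z).
Proof. by move=> ch z; apply: cvgN; exact: ch. Qed.

Lemma pform_continuous (L : 'M[R]_(m, n)) (B : 'M[R]_(q, m)) (M : 'M[R]_(p, l))
    (lam gam1 gam2 gam3 gam4 : R) :
  continuous (fun z : Hspace R n m l p => pform L B M lam gam1 gam2 gam3 gam4 z z).
Proof.
(* Destructuring is replaced by projections, so that continuity can be checked term by term. *)
rewrite (_ : (fun z => _) = fun z : Hspace R n m l p =>
  let x := z.1.1.1.1.1.1.1 in let s := z.1.1.1.1.1.1.2 in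
  let v := z.1.1.1.1.1.2 in let t := z.1.1.1.1.2 in let r := z.1.1.1.2 in
  let eta := z.1.1.2 in let xi := z.1.2 in let zeta := z.2 in
  pform L B M lam gam1 gam2 gam3 gam4 (x, s, v, t, r, eta, xi, zeta)
    (x, s, v, t, r, eta, xi, zeta)); last first.
  by apply/funext => -[[[[[[[x s] v] t] r] eta] xi] zeta].
rewrite /pform /= -/(cts _).
have c2 := cts_fst cts1; have c3 := cts_fst c2; have c4 := cts_fst c3.
have c5 := cts_fst c4; have c6 := cts_fst c5.
repeat (first [simple apply cts_D | simple apply cts_N | simple apply cts_cM
  | simple apply cts_dot | simple apply cts_mulmx]).
all: first [exact cts2 | exact (cts_snd cts1) | exact (cts_snd c2) | exact (cts_snd c3)
  | exact (cts_snd c4) | exact (cts_snd c5) | exact (cts_snd c6) | exact (cts_fst c6)].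
Qed.

Lemma xpart_continuous : continuous (@xpart R n m l p).
Proof.
rewrite (_ : @xpart R n m l p = fun z => z.1.1.1.1.1.1.1); last first.
  by apply/funext => -[[[[[[[x s] v] t] r] eta] xi] zeta].
exact: (cts_fst (cts_fst (cts_fst (cts_fst (cts_fst (cts_fst cts1)))))).
Qed.

End topology.

(** * Fixed points and convergence *)

Section fixed_points.
Variables (R : realType) (d n m l q p : nat).
Variables (A : 'M[R]_(d, n)) (y : 'cV[R]_d) (L : 'M[R]_(m, n)) (B : 'M[R]_(q, m)).
Variables (M : 'M[R]_(p, l)) (lam : R) (C : set 'cV[R]_n).
Variables (phi f : 'cV[R]_(m + l) -> \bar R) (g : 'cV[R]_p -> \bar R).
Variables (gam1 gam2 gam3 gam4 : R).
Hypotheses (C_neq0 : C !=set0) (C_closed : closed C) (C_convex : convex_set C).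
Hypotheses (fG : Gamma0 f) (gG : Gamma0 g).
Hypotheses (hA2 : assumption_A2 phi f g M) (hA3 : assumption_A3 phi f g L M).
Hypotheses (gam1_gt0 : 0 < gam1) (gam2_gt0 : 0 < gam2).
Hypotheses (gam3_gt0 : 0 < gam3) (gam4_gt0 : 0 < gam4).

Notation T := (Top A y L B M lam C f g gam1 gam2 gam3 gam4).

(** At z' = z the differences vanish and 2 u - u = u. The equation for s becomes eta = - M^T xi, the
    second block that [subgrad_phiP] asks for. *)
Lemma Fix_TopP x s v t r eta xi zeta :
  Fix T (x, s, v, t, r, eta, xi, zeta) <->
  [/\ C x /\ (forall z, C z -> 0 <= dot (forward A y L B lam x v r) (z - x)),
      eta = - (M^T *m xi) &
      [/\ subgrad f (col_mx v t)
            (col_mx (B^T *m (B *m (L *m x - v))) (- (M^T *m zeta))),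
          subgrad f (col_mx (L *m x) s) (col_mx r eta),
          subgrad g (M *m s) xi & subgrad g (M *m t) zeta]].
Proof.
have twice N (u : 'cV[R]_N) : 2 *: u - u = u.
  by rewrite scaler_nat mulr2n addrK.
apply: iff_trans (TopP A y L B M lam gam2 C_neq0 C_closed C_convex fG gG
  gam1_gt0 gam3_gt0 gam4_gt0 x s v t r eta xi zeta x s v t r eta xi zeta) _.
rewrite !twice !subrr !scaler0 !add0r.
have fP : (forall z, C z -> dot (- forward A y L B lam x v r) (z - x) <= 0) <->
    (forall z, C z -> 0 <= dot (forward A y L B lam x v r) (z - x)).
  by split=> H z /H; rewrite dotNl oppr_le0.
have sP : s = s - gam2 *: (eta + M^T *m xi) <-> eta = - (M^T *m xi).
  split=> [/eqP|->]; last by rewrite addNr scaler0 subr0.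
  rewrite -{1}[s]subr0 (inj_eq (addrI _)) eqr_opp eq_sym scaler_eq0 gt_eqF//=.
  by rewrite addr_eq0 => /eqP.
by split=> -[[Cx /fP xP] /sP E H]; split.
Qed.

(** The two inclusions for phi are split separately: zeta is the multiplier of g at M t and xi the
    one at M s. *)
Lemma Fix_Top_stationary x v t s r :
  (exists eta xi zeta, Fix T (x, s, v, t, r, eta, xi, zeta)) <->
  stationary A y L B lam C phi x v t s r.
Proof.
split=> [[eta [xi [zeta /Fix_TopP[Cx -> [fv fx gx gv]]]]]|[Cx]].
  split=> //; apply/(subgrad_phiP fG gG hA2 hA3).
    by exists zeta; rewrite col_mxKd.
  by exists xi; rewrite col_mxKd.
move=> /(subgrad_phiP fG gG hA2 hA3)[zeta []]; rewrite col_mxKd => gv fv.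
move=> /(subgrad_phiP fG gG hA2 hA3)[xi []]; rewrite col_mxKd => gx fx.
by exists (- (M^T *m xi)), xi, zeta; apply/Fix_TopP; split.
Qed.

End fixed_points.

Theorem theorem2 (R : realType) (d n m l q p : nat)
    (A : 'M[R]_(d, n)) (y : 'cV[R]_d) (L : 'M[R]_(m, n)) (B : 'M[R]_(q, m))
    (M : 'M[R]_(p, l)) (lam : R) (C : set 'cV[R]_n)
    (phi f : 'cV[R]_(m + l) -> \bar R) (g : 'cV[R]_p -> \bar R)
    (kappa gam1 gam2 gam3 gam4 : R)
    (lam_gt0 : 0 < lam)
    (C_neq0 : C !=set0) (C_closed : closed C) (C_convex : convex_set C)
    (phi_Gamma0 : Gamma0 phi) (f_Gamma0 : Gamma0 f) (g_Gamma0 : Gamma0 g)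
    (hA1 : assumption_A1 phi)
    (hA2 : assumption_A2 phi f g M)
    (hA3 : assumption_A3 phi f g L M)
    (Q_psd : psdmx (Qmx A L B lam))
    (kappa_gt1 : 1 < kappa)
    (gam1_gt0 : 0 < gam1) (gam2_gt0 : 0 < gam2)
    (gam3_gt0 : 0 < gam3) (gam4_gt0 : 0 < gam4)
    (hgam1 : posdefmx (gam1^-1 *: 1%:M - (kappa / 2) *: (A^T *m A)
                       - lam *: (L^T *m L)))
    (hgam2 : posdefmx (gam2^-1 *: 1%:M - 1%:M - M^T *m M))
    (hgam3 : (kappa / 2 + 2 / kappa) * opnorm B ^+ 2 <= gam3^-1)
    (hgam4 : posdefmx (gam4^-1 *: 1%:M - gam3 *: (M *m M^T))) :
  let T := Top A y L B M lam C f g gam1 gam2 gam3 gam4 in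
  let P : Hspace R n m l p -> Hspace R n m l p :=
    Pop L B M lam gam1 gam2 gam3 gam4 in
  let ipH : Hspace R n m l p -> Hspace R n m l p -> R :=
    @dotH R n m l p in
  let S := argmin C (J A y L B lam phi) in
  [/\ forall x : 'cV[R]_n,
        S x <->
        exists (s : 'cV[R]_l) (v : 'cV[R]_m) (t : 'cV[R]_l) (r : 'cV[R]_m)
               (eta : 'cV[R]_l) (xi zeta : 'cV[R]_p),
          Fix T (x, s, v, t, r, eta, xi, zeta),
      posdefop ipH P /\
      averaged (ip_norm (weighted_ip ipH P)) (kappa / (2 * kappa - 1)) T
    & S !=set0 ->
      forall z0 : Hspace R n m l p,
        exists xs : 'cV[R]_n,
          S xs /\ (fun k => xpart (iter k T z0)) @ \oo --> xs ].
Proof.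
move=> T P ipH S.
have FixP x v t s r := Fix_Top_stationary A y B lam C_neq0 C_closed C_convex
  f_Gamma0 g_Gamma0 hA2 hA3 gam1_gt0 gam2_gt0 gam3_gt0 gam4_gt0 x v t s r.
have part1 (x : 'cV[R]_n) : S x <-> exists s v t r eta xi zeta,
    Fix T (x, s, v, t, r, eta, xi, zeta).
  split=> [/(solution_stationary lam_gt0 C_convex phi_Gamma0 hA1 hA3)|].
    move=> [v [t [s [r /FixP[eta [xi [zeta Tfix]]]]]]].
    by exists s, v, t, r, eta, xi, zeta.
  move=> [s [v [t [r [eta [xi [zeta Tfix]]]]]]].
  apply: (stationary_solution lam_gt0 phi_Gamma0 hA1 hA3 Q_psd).
  by apply/FixP; exists eta, xi, zeta; exact: Tfix.
pose b := @pform R n m l q p L B M lam gam1 gam2 gam3 gam4.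
have bE : weighted_ip ipH P = b.
  by apply/funext => z; apply/funext => w; exact: dotH_Pop.
have step z w : let e := z - w - (T z - T w) in
    b (T z - T w) (T z - T w) + (1 - kappa^-1) * b e e <= b (z - w) (z - w).
  apply: (pform_step lam_gt0 Q_psd kappa_gt1 gam3_gt0 hgam1 hgam2 hgam3 hgam4).
  exact: Top_monotone.
have bD : forall u v w, b (u + v) w = b u w + b v w by move=> *; exact: pformDl.
have bZ : forall a u v, b (a *: u) v = a * b u v by move=> *; exact: pformZl.
have bC : forall u v, b u v = b v u by move=> *; exact: pformC.
have b_gt0 : forall z, z != 0 -> 0 < b z z.
  exact: (pform_gt0 lam_gt0 Q_psd kappa_gt1 gam3_gt0 hgam1 hgam2 hgam3 hgam4).
split=> //.
  split.
    exact: (posdefop_Pop lam_gt0 Q_psd kappa_gt1 gam3_gt0 hgam1 hgam2 hgam3 hgam4).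
  by rewrite bE; exact: averaged_of_step.
move=> [x0 /part1[s [v [t [r [eta [xi [zeta fix0]]]]]]]] z0.
have k0 : 0 < 1 - kappa^-1 by rewrite subr_gt0 invf_lt1// (lt_trans ltr01).
have b_cont : continuous (fun z => b z z) by exact: pform_continuous.
have [zf fixf zcvg] := krasnoselskii_mann bZ bC b_gt0
  (@compact_ball_Hspace R n m l p) b_cont z0 k0 fix0 step.
exists (xpart zf); split.
  apply/part1; move: fixf; move: zf {zcvg} => [[[[[[[x1 s1] v1] t1] r1] e1] xi1] ze1].
  by move=> fixf; exists s1, v1, t1, r1, e1, xi1, ze1.
apply: (@continuous_cvg _ _ _ \oo _ (fun k => iter k T z0) (@xpart R n m l p)) zcvg.
exact: xpart_continuous.
Qed.
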